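(* Let $f:\mathbb{H}^2\to\mathbb{H}^2$ be a bijection that sends hypercycles to hypercycles, i.e. for every hypercycle $h\subset\mathbb{H}^2$ the image $f(h)$ is a hypercycle. Then $f$ is an isometry of $\mathbb{H}^2$.
   Context: $\mathbb{H}^2=\{z\in\mathbb{C}:\mathrm{Im}(z)>0\}$ is the hyperbolic plane (upper half-plane model), with boundary $\partial\mathbb{H}^2=\mathbb{R}\cup\{\infty\}$. A hypercycle is the intersection with $\mathbb{H}^2$ of either a Euclidean circle that crosses $\mathbb{R}$ at two points and is not orthogonal to $\mathbb{R}$, or a Euclidean line that is neither vertical nor horizontal; it has two distinct endpoints in $\partial\mathbb{H}^2$. Equivalently, a hypercycle is a complete curve of constant geodesic curvature in $(0,1)$, or one connected component of the set of points at a fixed distance $r>0$ from a geodesic. Geodesics are not hypercycles. Isometries may preserve or reverse orientation. No continuity of $f$ is assumed. *)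

(* Defs.v *)
(* Stdlib reals, with the complex numbers of Coquelicot. *)
From Stdlib Require Export Reals FinFun Ensembles.
From Stdlib Require Image.
From Coquelicot Require Export Coquelicot.
Open Scope R_scope.

Record H2 : Type := mkH2 { pt :> C; Im_pt_pos : 0 < Im pt }.

(* sinh (d/2) = |z - w| / (2 sqrt (Im z Im w)): the distance of the Riemannian
   metric (dx^2 + dy^2) / y^2, of curvature -1. *)
Definition hdist (z w : H2) : R :=
  2 * arcsinh (Cmod (z - w) / (2 * sqrt (Im z * Im w))).

(* No orientation condition: orientation-reversing maps are allowed. *)
Definition is_isometry (f : H2 -> H2) : Prop :=
  Bijective f /\ forall z w : H2, hdist (f z) (f w) = hdist z w.

Definition circle (c : C) (r : R) : Ensemble C := fun z => Cmod (z - c) = r.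

Definition line (p d : C) : Ensemble C :=
  fun z => exists t : R, z = (p + t * d)%C.

(* The Euclidean inner product of C = R^2. *)
Definition inner (u v : C) : R := Re (u * Cconj v).

Definition crosses_real_axis_twice (c : C) (r : R) : Prop :=
  exists a b : R, a <> b /\ circle c r a /\ circle c r b.

(* Ci * (a - c) is tangent to the circle at a; RtoC 1 directs the real axis. *)
Definition orthogonal_to_real_axis (c : C) (r : R) : Prop :=
  forall a : R, circle c r a -> inner (Ci * (a - c)) (RtoC 1) = 0.

Definition vertical (d : C) : Prop := Re d = 0.
Definition horizontal (d : C) : Prop := Im d = 0.

Definition trace (S : Ensemble C) : Ensemble H2 := fun z => S z.

Definition is_hypercycle (h : Ensemble H2) : Prop :=
  (exists (c : C) (r : R),
      0 < r /\ crosses_real_axis_twice c r /\ ~ orthogonal_to_real_axis c r /\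
      Same_set H2 h (trace (circle c r)))
  \/
  (exists p d : C,
      d <> RtoC 0 /\ ~ vertical d /\ ~ horizontal d /\
      Same_set H2 h (trace (line p d))).

(* Main.v *)
Require Import Defs.
From Stdlib Require Import Reals FinFun Ensembles.
From Stdlib Require Image.
From Coquelicot Require Import Coquelicot.
From Stdlib Require Import Psatz Classical IndefiniteDescription.
Open Scope R_scope.

(** Fix a point p and let w = (z - conj p) / (z - p). This chart sends p to
    infinity and the other points of the hyperbolic plane onto the exterior
    |w| > 1 of the unit disc; hypercycles through p become the straight lines
    that cut the open disc off its centre, and the other hypercycles become
    circles. Read in the charts at p and at f p, the map f is a bijection g of
    the exterior that respects these lines and circles, and the distance from p
    to z depends on |w| only. So it is enough to show |g w| = |w|
    ([preserves_cycles_norm]) for every p.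

    The proof is algebraic and needs no continuity.

    - Parallel lines go to parallel lines ([parallel_lines_image]). If the
      images of two parallel lines crossed, there would be points a, b of the
      second line with images on both sides of the image of the first. A very
      large circle through a and b misses the first line, while the part of its
      image outside the disc is connected and has to meet the image of the first.

    - Near one point three families of parallel lines cover a neighbourhood. In
      suitable coordinates the positions x, y of two of the lines through a
      point determine the position x + y of the third, and g respects this, so
      the positions of the image lines satisfy a Pexider equation. They are
      bounded because all image lines meet the unit disc; hence they are affine
      functions, and g is affine near that point ([locally_affine]).

    - An affine map that sends an arc of a circle into a circle is a similarity
      ([germ_conformal]).

    - A similarity T that agrees with g near one point b agrees with g
      everywhere: a cycle through b and its image are matched by T, since they
      are matched near b, and any other point x is isolated by two cycles
      through x and b ([germ_determines_map]).

    - A similarity that maps the exterior of the unit disc onto itself fixes the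
      centre and has ratio 1 ([similarity_of_exterior]). *)

(** * Cycles outside the unit disc *)

Record cycle : Type := Cycle { quad : R; lin : C; cst : R }.

Definition eval (q : cycle) (w : C) : R :=
  quad q * inner w w + inner (lin q) w + cst q.

(** The cycles that represent hypercycles. By the inequality the circle or line
    cuts the unit circle in two points; [quad q = cst q] would make it
    orthogonal to the unit circle, that is, a geodesic. *)
Definition proper (q : cycle) : Prop :=
  (quad q + cst q) ^ 2 < inner (lin q) (lin q) /\ quad q <> cst q.

Definition outside (w : C) : Prop := 1 < inner w w.

Definition cross (u v : C) : R := fst u * snd v - snd u * fst v.

(** Since the point at infinity stands for the centre of the chart,
    [quad q = 0] says that the hypercycle passes through that centre. *)
Definition carries (g : C -> C) (q q' : cycle) : Prop :=
  proper q' /\ (quad q = 0 <-> quad q' = 0) /\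
  forall w, outside w -> (eval q w = 0 <-> eval q' (g w) = 0).

Definition preserves_cycles (g : C -> C) : Prop :=
  (forall w, outside w -> outside (g w)) /\
  (forall w w', outside w -> outside w' -> g w = g w' -> w = w') /\
  (forall w', outside w' -> exists w, outside w /\ g w = w') /\
  (forall q, proper q -> exists q', carries g q q').

Lemma innerE (u v : C) : inner u v = fst u * fst v + snd u * snd v.
Proof. unfold inner; simpl; unfold Re; simpl; ring. Qed.

Ltac coords :=
  unfold outside, proper, eval, cross in *; rewrite ?innerE in *; simpl in *.

Lemma inner_neq0 (n : C) : n <> RtoC 0 -> 0 < inner n n.
Proof.
  destruct n as [n1 n2]; intro H; coords.
  destruct (Req_dec n1 0) as [->|H1]; [|nra].
  destruct (Req_dec n2 0) as [->|H2]; [|nra].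
  now destruct H.
Qed.

Lemma proper_lin (q : cycle) : proper q -> 0 < inner (lin q) (lin q).
Proof. intros [H _]. pose proof (pow2_ge_0 (quad q + cst q)). lra. Qed.

(** * Parallel lines *)

Lemma small_quadratic (A B K : R) :
  0 < A -> exists e0, 0 < e0 /\ forall e, 0 < e < e0 -> 0 < A + B * e + K * e ^ 2.
Proof.
  intro HA.
  pose proof (Rabs_pos B); pose proof (Rabs_pos K).
  exists (Rmin 1 (A / (Rabs B + Rabs K + 1))); split.
  - apply Rmin_glb_lt; [lra|]. apply Rdiv_lt_0_compat; lra.
  - intros e [He1 He2].
    pose proof (Rmin_l 1 (A / (Rabs B + Rabs K + 1))).
    pose proof (Rmin_r 1 (A / (Rabs B + Rabs K + 1))).
    assert (e * (Rabs B + Rabs K + 1) < A).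
    { apply Rlt_le_trans with (A / (Rabs B + Rabs K + 1) * (Rabs B + Rabs K + 1)).
      - apply Rmult_lt_compat_r; lra.
      - right; field; lra. }
    assert (- B <= Rabs B) by (rewrite <- Rabs_Ropp; apply Rle_abs).
    assert (- K <= Rabs K) by (rewrite <- Rabs_Ropp; apply Rle_abs).
    assert (e ^ 2 <= e) by nra.
    assert (- K * e ^ 2 <= Rabs K * e) by nra.
    nra.
Qed.

(** The circle is a perturbation, by a small multiple of the circle of diameter
    ab, of the line through a and b. On the parallel line the equation of the line ab
    is a nonzero constant, and the equation of the circle of diameter ab is
    bounded below by -|a - b|^2 / 4. *)
Lemma circle_avoiding_parallel (n a b : C) (c1 c2 : R) :
  c1 <> c2 -> proper (Cycle 0 n c2) ->
  eval (Cycle 0 n c2) a = 0 -> eval (Cycle 0 n c2) b = 0 ->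
  exists q, proper q /\ quad q <> 0 /\ eval q a = 0 /\ eval q b = 0 /\
    forall w, eval (Cycle 0 n c1) w = 0 -> eval q w <> 0.
Proof.
  intros Hc [Hn Hc2] Ha Hb.
  destruct n as [n1 n2], a as [a1 a2], b as [b1 b2]; coords.
  assert (Hs : 0 < (c2 - c1) ^ 2) by (apply pow2_gt_0; lra).
  (* The factor s makes the line equation equal to s^2 > 0 on the parallel line. *)
  set (s := c2 - c1) in *.
  set (k := 1 + (a1 * b1 + a2 * b2)).
  set (m1 := a1 + b1); set (m2 := a2 + b2).
  destruct (small_quadratic (s ^ 2 * (n1 * n1 + n2 * n2 - c2 ^ 2))
     (- 2 * s * (n1 * m1 + n2 * m2 + k * c2)) (m1 ^ 2 + m2 ^ 2 - k ^ 2))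
    as [e1 [He1 H1]]; [nra|].
  destruct (small_quadratic (s ^ 2) (- ((a1 - b1) ^ 2 + (a2 - b2) ^ 2) / 4) 0)
    as [e2 [He2 H2]]; [nra|].
  destruct (small_quadratic (s ^ 2 * c2 ^ 2) (- 2 * s * c2 * (2 - k)) ((2 - k) ^ 2))
    as [e3 [He3 H3]]; [apply Rmult_lt_0_compat; [exact Hs|apply pow2_gt_0; lra]|].
  set (e := Rmin e1 (Rmin e2 e3) / 2).
  assert (He : 0 < e /\ e < e1 /\ e < e2 /\ e < e3).
  { pose proof (Rmin_l e1 (Rmin e2 e3)); pose proof (Rmin_r e1 (Rmin e2 e3)).
    pose proof (Rmin_l e2 e3); pose proof (Rmin_r e2 e3).
    assert (0 < Rmin e1 (Rmin e2 e3)) by (repeat apply Rmin_glb_lt; lra).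
    unfold e; lra. }
  specialize (H1 e ltac:(lra)); specialize (H2 e ltac:(lra));
  specialize (H3 e ltac:(lra)).
  exists (Cycle e (s * n1 - e * m1, s * n2 - e * m2) (e * (k - 1) + s * c2)).
  coords; repeat split.
  - nra.
  - intro E. assert (E' : s * c2 - e * (2 - k) = 0) by lra.
    assert ((s * c2 - e * (2 - k)) ^ 2 > 0) by lra.
    rewrite E' in *; lra.
  - lra.
  - transitivity (s * (0 * (a1 * a1 + a2 * a2) + (n1 * a1 + n2 * a2) + c2));
      [unfold k, m1, m2; ring | rewrite Ha; ring].
  - transitivity (s * (0 * (b1 * b1 + b2 * b2) + (n1 * b1 + n2 * b2) + c2));
      [unfold k, m1, m2; ring | rewrite Hb; ring].
  - intros [x y] Hw; coords.
    assert (Hw' : n1 * x + n2 * y = - c1) by lra.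
    apply Rgt_not_eq.
    replace (e * (x * x + y * y) + ((s * n1 - e * m1) * x + (s * n2 - e * m2) * y) +
      (e * (k - 1) + s * c2))
      with (s * (n1 * x + n2 * y + c2) + e * ((x - m1 / 2) ^ 2 + (y - m2 / 2) ^ 2)
            - e * ((a1 - b1) ^ 2 + (a2 - b2) ^ 2) / 4)
      by (unfold k, m1, m2; field).
    rewrite Hw'. replace (- c1 + c2) with s by (unfold s; ring).
    pose proof (pow2_ge_0 (x - m1 / 2)); pose proof (pow2_ge_0 (y - m2 / 2)).
    nra.
Qed.

(** The segment ab meets the line at a point X inside the circle, and the
    circle meets the line at points P1, P2 on both sides of X. The mean of
    |.|^2 over a, b weighted at X exceeds |X|^2 by minus the power of X, and so
    does the mean over P1, P2; hence P1 and P2 cannot both lie in the closed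
    disc when a and b lie outside. *)
Lemma outer_arc_not_separated (q : cycle) (n a b : C) (c : R) :
  quad q <> 0 -> 0 < inner n n -> outside a -> outside b ->
  eval q a = 0 -> eval q b = 0 ->
  eval (Cycle 0 n c) a * eval (Cycle 0 n c) b < 0 ->
  exists w, outside w /\ eval (Cycle 0 n c) w = 0 /\ eval q w = 0.
Proof.
  destruct q as [d [l1 l2] k], n as [n1 n2], a as [a1 a2], b as [b1 b2]; coords.
  intros Hd Hn Ha Hb Hqa Hqb Hab.
  set (la := 0 * (a1 * a1 + a2 * a2) + (n1 * a1 + n2 * a2) + c) in *.
  set (lb := 0 * (b1 * b1 + b2 * b2) + (n1 * b1 + n2 * b2) + c) in *.
  assert (Hl : la - lb <> 0) by nra.
  (* X = (x1, x2) below divides ab in the ratio th; the circle meets the line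
     at X + t (- n2, n1) for the roots t1 < 0 < t2 of t^2 = sg t + kap. *)
  set (th := la / (la - lb)).
  assert (Eth : th * (la - lb) = la) by (unfold th; field; lra).
  assert (Hth : 0 < th < 1) by nra.
  clearbody th.
  set (x1 := (1 - th) * a1 + th * b1); set (x2 := (1 - th) * a2 + th * b2).
  assert (HX : n1 * x1 + n2 * x2 + c = 0).
  { transitivity (la - th * (la - lb)); [unfold x1, x2, la, lb; ring|lra]. }
  set (N := n1 * n1 + n2 * n2) in *.
  set (S := (a1 - b1) ^ 2 + (a2 - b2) ^ 2).
  assert (HS : 0 < S).
  { pose proof (pow2_ge_0 (a1 - b1)); pose proof (pow2_ge_0 (a2 - b2)).
    destruct (Req_dec a1 b1) as [E1|E1]; [destruct (Req_dec a2 b2) as [E2|E2]|].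
    - exfalso; apply Hl; unfold la, lb; rewrite E1, E2; ring.
    - assert (0 < (a2 - b2) ^ 2) by (apply pow2_gt_0; lra). unfold S; lra.
    - assert (0 < (a1 - b1) ^ 2) by (apply pow2_gt_0; lra). unfold S; lra. }
  set (kap := th * (1 - th) * S / N).
  assert (Hkap : 0 < kap).
  { unfold kap; apply Rdiv_lt_0_compat; [|lra].
    repeat apply Rmult_lt_0_compat; lra. }
  set (sg := - (2 * d * (x2 * n1 - x1 * n2) + l2 * n1 - l1 * n2) / (d * N)).
  set (r := sqrt (sg ^ 2 + 4 * kap)).
  assert (Hr : r * r = sg ^ 2 + 4 * kap)
    by (unfold r; apply sqrt_sqrt; pose proof (pow2_ge_0 sg); lra).
  assert (Hrp : 0 <= r) by apply sqrt_pos.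
  assert (Hroot : forall t, t * t = sg * t + kap ->
     n1 * (x1 - t * n2) + n2 * (x2 + t * n1) + c = 0 /\
     d * ((x1 - t * n2) * (x1 - t * n2) + (x2 + t * n1) * (x2 + t * n1)) +
     (l1 * (x1 - t * n2) + l2 * (x2 + t * n1)) + k = 0).
  { intros t Ht; split; [lra|].
    transitivity (d * N * (t * t - sg * t - kap)
       + (1 - th) * (d * (a1 * a1 + a2 * a2) + (l1 * a1 + l2 * a2) + k)
       + th * (d * (b1 * b1 + b2 * b2) + (l1 * b1 + l2 * b2) + k)).
    - unfold sg, kap, x1, x2, S, N; field. unfold N in Hn; split; [lra|exact Hd].
    - rewrite Hqa, Hqb, Ht; ring. }
  set (t1 := (sg - r) / 2); set (t2 := (sg + r) / 2).
  assert (E1 : t1 * t1 = sg * t1 + kap) by (unfold t1; nra).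
  assert (E2 : t2 * t2 = sg * t2 + kap) by (unfold t2; nra).
  assert (E12 : t1 * t2 = - kap) by (unfold t1, t2; nra).
  assert (Hneg : t1 < 0 < t2).
  { assert (t1 <= t2) by (unfold t1, t2; lra). nra. }
  set (P := fun t => (x1 - t * n2) * (x1 - t * n2) + (x2 + t * n1) * (x2 + t * n1)).
  assert (HP : t2 * P t1 - t1 * P t2 =
     (t2 - t1) * ((1 - th) * (a1 * a1 + a2 * a2) + th * (b1 * b1 + b2 * b2))).
  { transitivity ((t2 - t1) * (x1 * x1 + x2 * x2 - t1 * t2 * N));
      [unfold P, N; ring|].
    rewrite E12. unfold kap, x1, x2, S; field; lra. }
  destruct (Rlt_dec 1 (P t1)) as [H1|H1].
  - exists (x1 - t1 * n2, x2 + t1 * n1); coords.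
    destruct (Hroot t1 E1) as [h1 h2].
    split; [exact H1|split; [lra|exact h2]].
  - destruct (Rlt_dec 1 (P t2)) as [H2|H2].
    + exists (x1 - t2 * n2, x2 + t2 * n1); coords.
      destruct (Hroot t2 E2) as [h1 h2].
      split; [exact H2|split; [lra|exact h2]].
    + exfalso.
      assert (1 < (1 - th) * (a1 * a1 + a2 * a2) + th * (b1 * b1 + b2 * b2)) by nra.
      nra.
Qed.

(** Far away in both directions on a line, every transversal line has been
    crossed and the unit disc has been left. *)
Lemma points_on_both_sides (n n' : C) (c c' : R) :
  0 < inner n' n' -> cross n n' <> 0 ->
  exists a b, outside a /\ outside b /\
    eval (Cycle 0 n' c') a = 0 /\ eval (Cycle 0 n' c') b = 0 /\
    eval (Cycle 0 n c) a * eval (Cycle 0 n c) b < 0.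
Proof.
  destruct n as [n1 n2], n' as [m1 m2]; coords; intros HN Hk.
  set (N := m1 * m1 + m2 * m2) in *.
  set (k := n1 * m2 - n2 * m1) in *.
  set (z1 := - c' * m1 / N); set (z2 := - c' * m2 / N).
  set (e := n1 * z1 + n2 * z2 + c).
  set (t := 1 + 1 / N + (e / k) ^ 2).
  assert (HiN : 0 < 1 / N) by (apply Rdiv_lt_0_compat; lra).
  assert (Ht : 1 < t) by (unfold t; pose proof (pow2_ge_0 (e / k)); lra).
  assert (HtN : 1 < t * t * N).
  { assert (1 < t * N).
    { unfold t; replace ((1 + 1 / N + (e / k) ^ 2) * N)
        with (N + 1 + (e / k) ^ 2 * N) by (field; lra).
      pose proof (pow2_ge_0 (e / k)); nra. }
    nra. }
  assert (Het : e * e < t * t * (k * k)).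
  { assert ((e / k) ^ 2 < t * t) by (unfold t in *; nra).
    replace (e * e) with ((e / k) ^ 2 * (k * k)) by (field; exact Hk).
    apply Rmult_lt_compat_r; nra. }
  assert (Hout : forall s, s * s = t * t ->
     1 < (z1 + s * m2) * (z1 + s * m2) + (z2 - s * m1) * (z2 - s * m1)).
  { intros s Hs.
    replace ((z1 + s * m2) * (z1 + s * m2) + (z2 - s * m1) * (z2 - s * m1))
      with (z1 * z1 + z2 * z2 + s * s * N) by (unfold z1, z2, N; field; unfold N in HN; lra).
    rewrite Hs; nra. }
  assert (Hon : forall s, m1 * (z1 + s * m2) + m2 * (z2 - s * m1) + c' = 0).
  { intro s; unfold z1, z2, N; field; unfold N in HN; lra. }
  exists (z1 + t * m2, z2 - t * m1), (z1 + - t * m2, z2 - - t * m1); coords.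
  repeat split.
  - apply Hout; ring.
  - apply Hout; ring.
  - pose proof (Hon t); lra.
  - pose proof (Hon (- t)); lra.
  - match goal with |- ?A < 0 => replace A with (e * e - t * t * (k * k))
      by (unfold e, k; ring) end. lra.
Qed.

Lemma parallel_lines_image (g : C -> C) (n : C) (c1 c2 : R) (q1 q2 : cycle) :
  preserves_cycles g -> c1 <> c2 -> proper (Cycle 0 n c2) ->
  carries g (Cycle 0 n c1) q1 -> carries g (Cycle 0 n c2) q2 ->
  cross (lin q1) (lin q2) = 0.
Proof.
  intros (Hout & Hinj & Hsurj & Hcyc) Hc Hp (P1 & Z1 & C1) (P2 & Z2 & C2).
  destruct (Req_dec (cross (lin q1) (lin q2)) 0) as [H|H]; [exact H|exfalso].
  pose proof (proper_lin _ P1) as L1; pose proof (proper_lin _ P2) as L2.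
  destruct q1 as [d1 n1 k1], q2 as [d2 n2 k2]; simpl in *.
  assert (d1 = 0) as -> by tauto; assert (d2 = 0) as -> by tauto.
  destruct (points_on_both_sides n1 n2 k1 k2 L2 H) as (a' & b' & Oa & Ob & Ea & Eb & Hab).
  destruct (Hsurj a' Oa) as (a & Ha & <-); destruct (Hsurj b' Ob) as (b & Hb & <-).
  apply C2 in Ea; [|exact Ha]; apply C2 in Eb; [|exact Hb].
  destruct (circle_avoiding_parallel n a b c1 c2 Hc Hp Ea Eb)
    as (q & Pq & Dq & Qa & Qb & Qd).
  (* The image q' of the circle is again a circle, not a line, so its part
     outside the disc is one arc. *)
  destruct (Hcyc q Pq) as (q' & Pq' & Dq' & Cq).
  destruct (outer_arc_not_separated q' n1 (g a) (g b) k1) as (w' & Ow & Ew & Ew');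
    auto; [tauto|now apply Cq|now apply Cq|].
  destruct (Hsurj w' Ow) as (w & Hw & <-).
  apply (Qd w); [now apply C1|now apply Cq].
Qed.

(** The normal m of the image lines depends on n only, by
    [parallel_lines_image]. The bound holds because image lines meet the unit
    disc, and it replaces continuity in the functional equation below. *)
Lemma parallel_class_image (g : C -> C) (n : C) :
  preserves_cycles g -> 0 < inner n n ->
  exists m : C, inner m m = 1 /\
    forall w, outside w -> 0 < (inner n w) ^ 2 < inner n n ->
      Rabs (inner m (g w)) <= 1 /\
      forall w', outside w' -> (inner n w' = inner n w <-> inner m (g w') = inner m (g w)).
Proof.
  intros Hg Hn.
  assert (Hprop : forall c, 0 < c ^ 2 < inner n n -> proper (Cycle 0 n (- c))).
  { intros c Hc; split; simpl; nra. }
  set (c0 := sqrt (inner n n) / 2).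
  assert (Hc0 : 0 < c0 ^ 2 < inner n n).
  { pose proof (sqrt_sqrt (inner n n) ltac:(lra)).
    unfold c0; split; nra. }
  destruct (proj2 (proj2 (proj2 Hg)) _ (Hprop _ Hc0)) as (q0 & Hq0).
  pose proof (proper_lin _ (proj1 Hq0)) as Hl.
  set (rho := sqrt (inner (lin q0) (lin q0))).
  assert (Hrho : 0 < rho) by now apply sqrt_lt_R0.
  assert (Hrho2 : rho * rho = inner (lin q0) (lin q0)) by (apply sqrt_sqrt; lra).
  set (m := (fst (lin q0) / rho, snd (lin q0) / rho)).
  assert (Hm : inner m m = 1).
  { rewrite innerE in *; unfold m; simpl.
    apply Rmult_eq_reg_l with (rho * rho); [|nra].
    rewrite Hrho2 at 2. field; lra. }
  exists m; split; [exact Hm|].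
  intros w Hw Hs.
  assert (Hq : exists q, carries g (Cycle 0 n (- inner n w)) q /\
                 cross (lin q0) (lin q) = 0).
  { destruct (Req_dec (inner n w) c0) as [->|Hne].
    - exists q0; split; [exact Hq0|unfold cross; ring].
    - destruct (proj2 (proj2 (proj2 Hg)) _ (Hprop _ Hs)) as (q & Hq).
      exists q; split; [exact Hq|].
      apply (parallel_lines_image g n (- c0) (- inner n w) q0 q); auto; lra. }
  destruct Hq as (q & (Pq & Zq & Cq) & Xq).
  pose proof (proper_lin _ Pq) as Lq.
  destruct Pq as [Pq _].
  destruct q as [d [l1 l2] k]; simpl in Zq.
  assert (d = 0) as -> by tauto.
  assert (Hl12 : exists kap, l1 = kap * fst m /\ l2 = kap * snd m).
  { exists (inner m (l1, l2)); unfold cross in Xq; rewrite innerE in *; unfold m in *; simpl in *.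
    assert (Hx : fst (lin q0) / rho * l2 = snd (lin q0) / rho * l1)
      by (apply Rmult_eq_reg_l with rho; [field_simplify; lra|lra]).
    set (p1 := fst (lin q0) / rho) in *; set (p2 := snd (lin q0) / rho) in *.
    split.
    - transitivity (l1 * (p1 * p1 + p2 * p2)); [rewrite Hm; ring|].
      transitivity (p1 * (p1 * l1) + p2 * (p2 * l1)); [ring|]. rewrite <- Hx; ring.
    - transitivity (l2 * (p1 * p1 + p2 * p2)); [rewrite Hm; ring|].
      transitivity (p1 * (p1 * l2) + p2 * (p2 * l2)); [ring|]. rewrite Hx; ring. }
  destruct Hl12 as (kap & -> & ->).
  clearbody m.
  assert (Hev : forall z, eval (Cycle 0 (kap * fst m, kap * snd m) k) z
                          = kap * inner m z + k).
  { intro z; unfold eval; rewrite !innerE; simpl; ring. }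
  assert (Hk : k ^ 2 < kap ^ 2 /\ kap <> 0).
  { rewrite innerE in Pq, Lq, Hm; simpl in Pq, Lq.
    replace (kap * fst m * (kap * fst m) + kap * snd m * (kap * snd m))
      with (kap ^ 2 * (fst m * fst m + snd m * snd m)) in * by ring.
    rewrite Hm in *; split; nra. }
  assert (Hself : kap * inner m (g w) + k = 0).
  { rewrite <- Hev; apply Cq; [exact Hw|]. unfold eval; simpl; ring. }
  split.
  - apply Rabs_le.
    assert (kap ^ 2 * (inner m (g w)) ^ 2 < kap ^ 2) by
      (replace (kap ^ 2 * (inner m (g w)) ^ 2) with ((- k) ^ 2)
        by (replace (- k) with (kap * inner m (g w)) by lra; ring); lra).
    assert ((inner m (g w)) ^ 2 < 1) by nra.
    nra.
  - intros w' Hw'. 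
    specialize (Cq w' Hw'). rewrite Hev in Cq. unfold eval in Cq; simpl in Cq.
    split; intro E.
    + apply Rmult_eq_reg_l with kap; [|tauto].
      assert (kap * inner m (g w') + k = 0) by (apply Cq; lra). lra.
    + rewrite E in Cq. apply proj2 in Cq. specialize (Cq Hself). lra.
Qed.

(** * An affine germ *)

(** After subtracting a linear function the additive map D vanishes at h, hence
    at h / 2. So D has period h / 2 on [0, h], and D (2 x) = 2 D x; these two
    halve every bound for D on [0, h], which forces D = 0. *)
Lemma additive_bounded_linear (A : R -> R) (h M : R) :
  0 < h -> (forall x, Rabs x <= h -> Rabs (A x) <= M) ->
  (forall x y, Rabs x <= h -> Rabs y <= h -> Rabs (x + y) <= h ->
     A (x + y) = A x + A y) ->
  forall x, Rabs x <= h -> A x = x * (A h / h).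
Proof.
  intros Hh HM Hadd.
  set (D := fun x => A x - x * (A h / h)).
  assert (Dadd : forall x y, 0 <= x -> 0 <= y -> x + y <= h -> D (x + y) = D x + D y).
  { intros x y Hx Hy Hxy; unfold D.
    rewrite Hadd; [ring|..]; rewrite Rabs_pos_eq; lra. }
  assert (Dh : D (h / 2) = 0).
  { assert (D h = 0) by (unfold D; field; lra).
    assert (D (h / 2 + h / 2) = D (h / 2) + D (h / 2)) by (apply Dadd; lra).
    replace (h / 2 + h / 2) with h in H0 by field. lra. }
  assert (Dbound : forall k x, 0 <= x <= h -> Rabs (D x) <= 2 * M / 2 ^ k).
  { induction k as [|k IH]; intros x Hx.
    - simpl. unfold D.
      assert (Rabs (A x) <= M) by (apply HM; rewrite Rabs_pos_eq; lra).
      assert (Rabs (A h) <= M) by (apply HM; rewrite Rabs_pos_eq; lra).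
      assert (Rabs (x * (A h / h)) <= Rabs (A h)).
      { replace (x * (A h / h)) with (x / h * A h) by (field; lra).
        rewrite Rabs_mult, (Rabs_pos_eq (x / h)).
        - pose proof (Rabs_pos (A h)).
          assert (x / h <= 1) by (apply Rle_div_l; lra). nra.
        - apply Rdiv_le_0_compat; lra. }
      pose proof (Rabs_triang (A x) (- (x * (A h / h)))) as T.
      rewrite Rabs_Ropp in T. unfold Rminus. lra.
    - assert (E : 2 * M / 2 ^ S k = (2 * M / 2 ^ k) / 2)
        by (simpl; field; apply pow_nonzero; lra).
      rewrite E.
      assert (Hlow : forall t, 0 <= t <= h / 2 -> Rabs (D t) <= 2 * M / 2 ^ k / 2).
      { intros t Ht. specialize (IH (t + t) ltac:(lra)).
        rewrite Dadd in IH by lra.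
        replace (D t + D t) with (2 * D t) in IH by ring.
        rewrite Rabs_mult, (Rabs_pos_eq 2) in IH by lra. lra. }
      destruct (Rle_dec x (h / 2)) as [H|H]; [apply Hlow; lra|].
      replace x with ((x - h / 2) + h / 2) by ring.
      rewrite Dadd, Dh, Rplus_0_r by lra. apply Hlow; lra. }
  assert (Dzero : forall x, 0 <= x <= h -> D x = 0).
  { intros x Hx. destruct (Req_dec (D x) 0) as [E|E]; [exact E|exfalso].
    apply Rabs_pos_lt in E.
    destruct (Pow_x_infinity 2 ltac:(rewrite Rabs_pos_eq; lra)
                (2 * M / Rabs (D x) + 1)) as [k Hk].
    specialize (Hk k (le_n k)). rewrite Rabs_pos_eq in Hk by (apply pow_le; lra).
    specialize (Dbound k x Hx).
    assert (Hp : 0 < 2 ^ k) by (apply pow_lt; lra).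
    apply Rle_div_r in Dbound; [|exact Hp].
    assert (2 * M = 2 * M / Rabs (D x) * Rabs (D x)) by (field; lra).
    nra. }
  intros x Hx. apply Rabs_le_between in Hx.
  destruct (Rle_dec 0 x) as [H|H].
  - specialize (Dzero x ltac:(lra)). unfold D in Dzero. lra.
  - specialize (Dzero (- x) ltac:(lra)). unfold D in Dzero.
    assert (A0 : A 0 = 0).
    { assert (A (0 + 0) = A 0 + A 0) by (apply Hadd; rewrite ?Rplus_0_r, Rabs_R0; lra).
      rewrite Rplus_0_r in H0; lra. }
    assert (A (x + - x) = A x + A (- x))
      by (apply Hadd; apply Rabs_le; lra).
    replace (x + - x) with 0 in H0 by ring. lra.
Qed.

(** A point from which lines u - k v = c with k = 1/4, -1/4, 1/2 cut the open
    unit disc off its centre. *)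
Definition base : C := (0, 2).

Definition affine_map (o a1 a2 y : C) : C :=
  (fst o + fst y * fst a1 + snd y * fst a2, snd o + fst y * snd a1 + snd y * snd a2).

Lemma cross_neq0 (m1 m2 z z' : C) :
  inner m1 m1 = 1 -> inner m1 z' = inner m1 z -> inner m2 z' <> inner m2 z ->
  cross m1 m2 <> 0.
Proof.
  destruct m1 as [a b], m2 as [c d], z as [x y], z' as [x' y']; coords.
  intros U E1 E2 X; apply E2.
  assert (H : exists k, c = k * a /\ d = k * b).
  { exists (c * a + d * b); split.
    - transitivity (c * (a * a + b * b)); [rewrite U; ring|].
      replace (c * (a * a + b * b)) with ((c * a + d * b) * a - b * (a * d - b * c)) by ring.
      rewrite X; ring.
    - transitivity (d * (a * a + b * b)); [rewrite U; ring|].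
      replace (d * (a * a + b * b)) with ((c * a + d * b) * b + a * (a * d - b * c)) by ring.
      rewrite X; ring. }
  destruct H as (k & -> & ->).
  transitivity (k * (a * x' + b * y')); [ring|rewrite E1; ring].
Qed.

(** In the coordinates x, y of W below, the lines with the normals
    (1, -1/4), (1, 1/4), (1, -1/2) are those where x, y, x + y are constant. The
    normals m1, m2, m3 of the image lines are pairwise independent, so
    m3 = lam m1 + mu m2 and the heights al, be of the image lines satisfy
    lam al x + mu be y = lam al (x + y) + mu be 0. *)
Lemma locally_affine (g : C -> C) :
  preserves_cycles g ->
  exists (h : R) (a1 a2 : C), 0 < h /\ cross a1 a2 <> 0 /\
    forall y : C, Rabs (fst y) <= h -> Rabs (snd y) <= h ->
      g (base + y)%C = affine_map (g base) a1 a2 y.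
Proof.
  intro Hg.
  destruct (parallel_class_image g (1, - / 4) Hg) as (m1 & U1 & F1);
    [coords; lra|].
  destruct (parallel_class_image g (1, / 4) Hg) as (m2 & U2 & F2);
    [coords; lra|].
  destruct (parallel_class_image g (1, - / 2) Hg) as (m3 & U3 & F3);
    [coords; lra|].
  (* The bound 1/50 keeps these lines at a distance in (0, 1) from the centre. *)
  set (W := fun x y : R => (x - 3 * y, 2 - 4 * x - 12 * y) : C).
  assert (OW : forall x y, Rabs x <= / 50 -> Rabs y <= / 50 -> outside (W x y)).
  { intros x y Hx Hy. apply Rabs_le_between in Hx, Hy. unfold W; coords.
    assert (3 / 2 < 2 - 4 * x - 12 * y) by lra.
    pose proof (pow2_ge_0 (x - 3 * y)). nra. }
  set (N1 := inner (1, - / 4)); set (N2 := inner (1, / 4)); set (N3 := inner (1, - / 2)).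
  fold N1 in F1; fold N2 in F2; fold N3 in F3.
  assert (E1 : forall x y, N1 (W x y) = 2 * x - / 2)
    by (intros; unfold N1, W; coords; field).
  assert (E2 : forall x y, N2 (W x y) = / 2 - 6 * y)
    by (intros; unfold N2, W; coords; field).
  assert (E3 : forall x y, N3 (W x y) = 3 * (x + y) - 1)
    by (intros; unfold N3, W; coords; field).
  assert (G1 : forall x y, Rabs x <= / 50 -> Rabs y <= / 50 ->
    Rabs (inner m1 (g (W x y))) <= 1 /\ forall x' y', Rabs x' <= / 50 -> Rabs y' <= / 50 ->
      (x' = x <-> inner m1 (g (W x' y')) = inner m1 (g (W x y)))).
  { intros x y Hx Hy. destruct (F1 (W x y) (OW x y Hx Hy)) as [B I].
    - rewrite E1; unfold N1; rewrite innerE; simpl; apply Rabs_le_between in Hx.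
      assert (- 3 / 5 < 2 * x - / 2 < - 2 / 5) by lra. split; nra.
    - split; [exact B|]. intros x' y' Hx' Hy'.
      rewrite <- I by auto. rewrite !E1. lra. }
  assert (G2 : forall x y, Rabs x <= / 50 -> Rabs y <= / 50 ->
    Rabs (inner m2 (g (W x y))) <= 1 /\ forall x' y', Rabs x' <= / 50 -> Rabs y' <= / 50 ->
      (y' = y <-> inner m2 (g (W x' y')) = inner m2 (g (W x y)))).
  { intros x y Hx Hy. destruct (F2 (W x y) (OW x y Hx Hy)) as [B I].
    - rewrite E2; unfold N2; rewrite innerE; simpl; apply Rabs_le_between in Hy.
      assert (1 / 5 < / 2 - 6 * y < 4 / 5) by lra. split; nra.
    - split; [exact B|]. intros x' y' Hx' Hy'.
      rewrite <- I by auto. rewrite !E2. lra. }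
  assert (G3 : forall x y, Rabs x <= / 50 -> Rabs y <= / 50 -> Rabs (x + y) <= / 50 ->
     forall x' y', Rabs x' <= / 50 -> Rabs y' <= / 50 ->
      (x' + y' = x + y <-> inner m3 (g (W x' y')) = inner m3 (g (W x y)))).
  { intros x y Hx Hy Hxy. destruct (F3 (W x y) (OW x y Hx Hy)) as [B I].
    - rewrite E3; unfold N3; rewrite innerE; simpl; apply Rabs_le_between in Hxy.
      assert (- 11 / 10 < 3 * (x + y) - 1 < - 9 / 10) by lra. split; nra.
    - intros x' y' Hx' Hy'.
      rewrite <- I by auto. rewrite !E3. lra. }
  clear F1 F2 F3 E1 E2 E3 N1 N2 N3.
  assert (Z0 : Rabs 0 <= / 50) by (rewrite Rabs_R0; lra).
  assert (Z1 : Rabs (/ 50) <= / 50) by (rewrite Rabs_pos_eq; lra).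
  assert (X12 : cross m1 m2 <> 0).
  { apply (cross_neq0 m1 m2 (g (W 0 0)) (g (W 0 (/ 50))) U1).
    - now apply G1.
    - intro E; apply G2 in E; auto; lra. }
  assert (X31 : cross m1 m3 <> 0).
  { apply (cross_neq0 m1 m3 (g (W 0 0)) (g (W 0 (/ 50))) U1).
    - now apply G1.
    - intro E; apply G3 in E; rewrite ?Rplus_0_r; auto; lra. }
  assert (X32 : cross m2 m3 <> 0).
  { apply (cross_neq0 m2 m3 (g (W 0 0)) (g (W (/ 50) 0)) U2).
    - now apply G2.
    - intro E; apply G3 in E; rewrite ?Rplus_0_r; auto; lra. }
  set (lam := cross m3 m2 / cross m1 m2); set (mu := cross m1 m3 / cross m1 m2).
  assert (Hlam : lam <> 0).
  { unfold lam; intro E. apply X32. unfold cross in *.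
    assert (fst m3 * snd m2 - snd m3 * fst m2 = 0); [|lra].
    apply (Rmult_eq_reg_r (/ (fst m1 * snd m2 - snd m1 * fst m2)));
      [unfold Rdiv in E; lra|now apply Rinv_neq_0_compat]. }
  assert (Hmu : mu <> 0).
  { unfold mu, Rdiv; apply Rmult_integral_contrapositive; split; [exact X31|].
    now apply Rinv_neq_0_compat. }
  assert (M3 : forall z, inner m3 z = lam * inner m1 z + mu * inner m2 z).
  { intro z; unfold lam, mu; unfold cross in *; rewrite !innerE; field; exact X12. }
  clearbody lam mu.
  set (al := fun x => inner m1 (g (W x 0))).
  set (be := fun y => inner m2 (g (W 0 y))).
  assert (Hal : forall x y, Rabs x <= / 50 -> Rabs y <= / 50 ->
                  inner m1 (g (W x y)) = al x)
    by (intros; unfold al; now apply G1).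
  assert (Hbe : forall x y, Rabs x <= / 50 -> Rabs y <= / 50 ->
                  inner m2 (g (W x y)) = be y)
    by (intros; unfold be; now apply G2).
  assert (Pex : forall x y, Rabs x <= / 50 -> Rabs y <= / 50 -> Rabs (x + y) <= / 50 ->
     lam * al x + mu * be y = lam * al (x + y) + mu * be 0).
  { intros x y Hx Hy Hxy.
    rewrite <- (Hal x y), <- (Hbe x y), <- (Hal (x + y) 0), <- (Hbe (x + y) 0) by auto.
    rewrite <- !M3. symmetry. apply (G3 x y Hx Hy Hxy (x + y) 0 Hxy Z0); ring. }
  set (A := fun x => al x - al 0).
  assert (Bel : forall y, Rabs y <= / 50 -> mu * (be y - be 0) = lam * A y).
  { intros y Hy. specialize (Pex 0 y Z0 Hy). rewrite Rplus_0_l in Pex.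
    unfold A. specialize (Pex Hy). lra. }
  assert (Alin : forall x, Rabs x <= / 50 -> A x = x * (A (/ 50) / (/ 50))).
  { apply additive_bounded_linear with 2; [lra|..].
    - intros x Hx. unfold A. destruct (G1 x 0 Hx Z0) as [B _].
      destruct (G1 0 0 Z0 Z0) as [B0 _]. fold (al x) in B; fold (al 0) in B0.
      pose proof (Rabs_triang (al x) (- al 0)) as T. rewrite Rabs_Ropp in T.
      unfold Rminus; lra.
    - intros x y Hx Hy Hxy. apply Rmult_eq_reg_l with lam; [|exact Hlam].
      rewrite Rmult_plus_distr_l, <- (Bel y Hy).
      specialize (Pex x y Hx Hy Hxy). unfold A; lra. }
  set (k := A (/ 50) / (/ 50)) in *.
  assert (Hk : k <> 0).
  { intro E. assert (A (/ 50) = 0) by (rewrite Alin, E by exact Z1; ring).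
    assert (/ 50 = 0); [|lra].
    apply (proj2 (G1 0 0 Z0 Z0) (/ 50) 0 Z1 Z0).
    fold (al 0); fold (al (/ 50)). unfold A in H; lra. }
  clearbody k.
  set (l := lam * k / mu).
  assert (Hl : l <> 0).
  { unfold l, Rdiv. repeat apply Rmult_integral_contrapositive_currified;
      auto using Rinv_neq_0_compat. }
  assert (Balin : forall y, Rabs y <= / 50 -> be y = be 0 + y * l).
  { intros y Hy. apply Rmult_eq_reg_l with mu; [|exact Hmu].
    specialize (Bel y Hy). rewrite Alin in Bel by exact Hy.
    unfold l. transitivity (mu * be 0 + lam * (y * k)); [lra|field; exact Hmu]. }
  assert (W0 : base = W 0 0) by (unfold base, W; f_equal; ring).
  (* e1 and e2 are the increments of g along x and y, by Cramer's rule. *)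
  set (D := cross m1 m2) in *.
  set (e1 := (k * snd m2 / D, - (k * fst m2) / D) : C).
  set (e2 := (- (l * snd m1) / D, l * fst m1 / D) : C).
  exists (/ 100),
    (fst e1 / 2 - fst e2 / 6, snd e1 / 2 - snd e2 / 6),
    (- fst e1 / 8 - fst e2 / 24, - snd e1 / 8 - snd e2 / 24).
  split; [lra|split].
  - assert (k * l / D <> 0).
    { unfold Rdiv. repeat apply Rmult_integral_contrapositive_currified;
      auto using Rinv_neq_0_compat. }
    replace (cross _ _) with (- (k * l / D) / 24); [lra|].
    unfold cross, e1, e2; simpl. unfold D, cross; field. exact X12.
  - intros [y1 y2] H1 H2; simpl in H1, H2.
    apply Rabs_le_between in H1, H2.
    (* x and y solve W x y = base + (y1, y2). *)
    set (x := y1 / 2 - y2 / 8); set (y := - y1 / 6 - y2 / 24).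
    assert (Hx : Rabs x <= / 50) by (apply Rabs_le; unfold x; lra).
    assert (Hy : Rabs y <= / 50) by (apply Rabs_le; unfold y; lra).
    replace (base + (y1, y2))%C with (W x y)
      by (unfold base, W, x, y, Cplus; simpl; f_equal; field).
    rewrite W0.
    assert (Ex : inner m1 (g (W x y)) = inner m1 (g (W 0 0)) + x * k).
    { rewrite !Hal, <- Alin by auto. unfold A; ring. }
    assert (Ey : inner m2 (g (W x y)) = inner m2 (g (W 0 0)) + y * l).
    { rewrite !Hbe, Balin by auto. ring. }
    rewrite !innerE in Ex, Ey. unfold D in *; clear D; unfold cross in X12.
    unfold affine_map, e1, e2; simpl.
    destruct (g (W x y)) as [z1 z2], (g (W 0 0)) as [o1 o2]; simpl in *.
    unfold cross; f_equal; (apply Rmult_eq_reg_l with (fst m1 * snd m2 - snd m1 * fst m2);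
      [|exact X12]).
    + transitivity (snd m2 * (fst m1 * z1 + snd m1 * z2) - snd m1 * (fst m2 * z1 + snd m2 * z2));
        [ring|]. rewrite Ex, Ey; unfold x, y; field; exact X12.
    + transitivity (fst m1 * (fst m2 * z1 + snd m2 * z2) - fst m2 * (fst m1 * z1 + snd m1 * z2));
        [ring|]. rewrite Ex, Ey; unfold x, y; field; exact X12.
Qed.

(** * From the germ to the whole domain *)

(** The gradient of [eval q] at [base]. *)
Definition gradient (q : cycle) : C := (fst (lin q), 4 * quad q + snd (lin q)).

(** The displacement from [base] to the second point where the cycle meets the
    line through [base] of direction JG - s d G, with G the gradient, J the
    quarter turn and d the leading coefficient: as s tends to 0 the line tends
    to the tangent and the point tends to [base]. For a line, where d = 0, it
    is s JG. *)
Definition arc (q : cycle) (s : R) : C :=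
  let G := gradient q in
  ((- s * snd G - quad q * s ^ 2 * fst G) / (1 + quad q ^ 2 * s ^ 2),
   (s * fst G - quad q * s ^ 2 * snd G) / (1 + quad q ^ 2 * s ^ 2)).

Lemma one_plus_sqr_pos (d s : R) : 1 <= 1 + d ^ 2 * s ^ 2.
Proof. pose proof (pow2_ge_0 (d * s)). nra. Qed.

Lemma arc_on_cycle (q : cycle) (s : R) :
  eval q base = 0 -> eval q (base + arc q s)%C = 0.
Proof.
  intro H. pose proof (one_plus_sqr_pos (quad q) s).
  destruct q as [d [l1 l2] c]; unfold arc, gradient, base in *; coords.
  transitivity (d * (0 * 0 + 2 * 2) + (l1 * 0 + l2 * 2) + c); [field; lra|exact H].
Qed.

Lemma arc_small (q : cycle) (h : R) :
  0 < h -> exists s0, 0 < s0 /\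
    forall s, Rabs s <= s0 -> Rabs (fst (arc q s)) <= h /\ Rabs (snd (arc q s)) <= h.
Proof.
  intro Hh. unfold arc; destruct (gradient q) as [G1 G2]; destruct q as [d n c];
    simpl fst; simpl snd; simpl quad.
  set (K := 1 + Rabs d + Rabs G1 + Rabs G2 + Rabs d * (Rabs G1 + Rabs G2)).
  pose proof (Rabs_pos d); pose proof (Rabs_pos G1); pose proof (Rabs_pos G2).
  assert (0 <= Rabs d * Rabs G1) by now apply Rmult_le_pos.
  assert (0 <= Rabs d * Rabs G2) by now apply Rmult_le_pos.
  assert (HK : 1 <= K) by (unfold K; lra).
  exists (Rmin 1 (h / K)); split.
  - apply Rmin_glb_lt; [lra|apply Rdiv_lt_0_compat; lra].
  - intros s Hs. pose proof (Rmin_l 1 (h / K)); pose proof (Rmin_r 1 (h / K)).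
    pose proof (Rabs_pos s).
    assert (HsK : Rabs s * K <= h) by (apply Rle_div_r; lra).
    pose proof (one_plus_sqr_pos d s).
    assert (Bound : forall u v, Rabs u <= K - Rabs d * Rabs v -> 0 <= Rabs d * Rabs v ->
       Rabs ((s * u - d * s ^ 2 * v) / (1 + d ^ 2 * s ^ 2)) <= h).
    { intros u v Hu Hv. unfold Rdiv. rewrite Rabs_mult.
      rewrite (Rabs_pos_eq (/ _)) by (left; apply Rinv_0_lt_compat; lra).
      apply Rle_div_l; [lra|].
      apply Rle_trans with h;
        [|rewrite <- (Rmult_1_r h) at 1; apply Rmult_le_compat_l; lra].
      apply Rle_trans with (Rabs s * K); [|exact HsK].
      pose proof (Rabs_triang (s * u) (- (d * s ^ 2 * v))) as T.
      rewrite Rabs_Ropp, !Rabs_mult, (Rabs_pos_eq (s ^ 2)) in T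
        by apply pow2_ge_0.
      set (a := Rabs s) in *; set (b := Rabs d * Rabs v) in *.
      assert (a * Rabs u <= a * (K - b)) by (apply Rmult_le_compat_l; lra).
      assert (Rabs d * s ^ 2 * Rabs v <= a * b).
      { rewrite <- (pow2_abs s); fold a.
        replace (Rabs d * a ^ 2 * Rabs v) with (a * (a * b)) by (unfold b; ring).
        apply Rmult_le_compat_l; [lra|].
        rewrite <- (Rmult_1_l b) at 2. apply Rmult_le_compat_r; lra. }
      unfold Rminus at 1. lra. }
    split.
    + replace (- s * G2) with (s * - G2) by ring. apply Bound; [|lra].
      rewrite Rabs_Ropp; unfold K; lra.
    + apply Bound; [|lra]. unfold K; lra.
Qed.

(** Evaluation at s0, - s0, s0 / 2 and - s0 / 2 already determines a cubic. *)
Lemma cubic_vanishing (c0 c1 c2 c3 s0 : R) :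
  0 < s0 ->
  (forall s, s <> 0 -> Rabs s <= s0 -> c0 + c1 * s + c2 * s ^ 2 + c3 * s ^ 3 = 0) ->
  c0 = 0 /\ c1 = 0 /\ c2 = 0 /\ c3 = 0.
Proof.
  intros Hs H.
  assert (P1 := H s0 ltac:(lra) ltac:(rewrite Rabs_pos_eq; lra)).
  assert (P2 := H (- s0) ltac:(lra) ltac:(rewrite Rabs_Ropp, Rabs_pos_eq; lra)).
  assert (P3 := H (s0 / 2) ltac:(lra) ltac:(rewrite Rabs_pos_eq; lra)).
  assert (P4 := H (- (s0 / 2)) ltac:(lra) ltac:(rewrite Rabs_Ropp, Rabs_pos_eq; lra)).
  assert (C0 : c0 = 0) by lra.
  assert (E2 : c2 * s0 ^ 2 = 0) by lra.
  assert (E3 : c3 * s0 ^ 3 = 0) by lra.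
  assert (E1 : c1 * s0 = 0) by lra.
  assert (N2 : s0 ^ 2 <> 0) by (apply pow_nonzero; lra).
  assert (N3 : s0 ^ 3 <> 0) by (apply pow_nonzero; lra).
  apply Rmult_integral in E1, E2, E3. repeat split; try tauto. lra.
Qed.

(** Substituting [arc] and multiplying by (1 + d^2 s^2)^2 / s turns the conic
    into a cubic polynomial in s, whose coefficients vanish. With Q the quadratic
    part and n the linear part, the conclusions read n.JG = 0, Q(JG) = d n.G,
    d Q(JG, G) = 0 and d^2 Q(G) = d^3 n.G. *)
Lemma conic_along_arc (q : cycle) (p11 p12 p22 n1 n2 s0 : R) :
  0 < s0 ->
  (forall s, Rabs s <= s0 ->
     let y := arc q s in
     p11 * fst y ^ 2 + 2 * p12 * fst y * snd y + p22 * snd y ^ 2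
       + n1 * fst y + n2 * snd y = 0) ->
  let d := quad q in let G1 := fst (gradient q) in let G2 := snd (gradient q) in
  n2 * G1 - n1 * G2 = 0 /\
  p11 * G2 ^ 2 - 2 * p12 * G1 * G2 + p22 * G1 ^ 2 = d * (n1 * G1 + n2 * G2) /\
  d * ((p22 - p11) * G1 * G2 + p12 * (G1 ^ 2 - G2 ^ 2)) = 0 /\
  d ^ 2 * (p11 * G1 ^ 2 + 2 * p12 * G1 * G2 + p22 * G2 ^ 2)
    = d ^ 3 * (n1 * G1 + n2 * G2).
Proof.
  intros Hs H d G1 G2.
  destruct (cubic_vanishing
     (n2 * G1 - n1 * G2)
     (p11 * G2 ^ 2 - 2 * p12 * G1 * G2 + p22 * G1 ^ 2 - d * (n1 * G1 + n2 * G2))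
     (d ^ 2 * (n2 * G1 - n1 * G2)
        - 2 * d * ((p22 - p11) * G1 * G2 + p12 * (G1 ^ 2 - G2 ^ 2)))
     (d ^ 2 * (p11 * G1 ^ 2 + 2 * p12 * G1 * G2 + p22 * G2 ^ 2)
        - d ^ 3 * (n1 * G1 + n2 * G2)) s0 Hs) as (E0 & E1 & E2 & E3).
  - intros s Hs0 Hss. specialize (H s Hss); cbv zeta in H.
    change (fst (arc q s)) with ((- s * G2 - d * s ^ 2 * G1) / (1 + d ^ 2 * s ^ 2)) in H.
    change (snd (arc q s)) with ((s * G1 - d * s ^ 2 * G2) / (1 + d ^ 2 * s ^ 2)) in H.
    pose proof (one_plus_sqr_pos d s).
    apply Rmult_eq_reg_l with (s / (1 + d ^ 2 * s ^ 2) ^ 2).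
    + rewrite Rmult_0_r, <- H. field. lra.
    + apply Rmult_integral_contrapositive_currified; [exact Hs0|].
      apply Rinv_neq_0_compat, pow_nonzero; lra.
  - rewrite E0 in E2. repeat split; lra.
Qed.

(** On the cycle, |G|^2 = |lin q|^2 - 4 quad q cst q, which exceeds
    (quad q - cst q)^2. *)
Lemma gradient_neq0 (q : cycle) :
  proper q -> eval q base = 0 -> 0 < inner (gradient q) (gradient q).
Proof.
  destruct q as [d [l1 l2] c]; unfold gradient, base; coords; intros [H1 H2] H.
  assert (0 < (d - c) ^ 2) by (apply pow2_gt_0; lra). nra.
Qed.

Lemma eval_affine_map (q : cycle) (o a1 a2 y : C) :
  eval q (affine_map o a1 a2 y) =
  quad q * inner a1 a1 * fst y ^ 2 + 2 * (quad q * inner a1 a2) * fst y * snd y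
  + quad q * inner a2 a2 * snd y ^ 2
  + (2 * quad q * inner o a1 + inner (lin q) a1) * fst y
  + (2 * quad q * inner o a2 + inner (lin q) a2) * snd y + eval q o.
Proof. unfold affine_map; coords; ring. Qed.

Lemma inner_both_zero (l a1 a2 : C) :
  cross a1 a2 <> 0 -> inner l a1 = 0 -> inner l a2 = 0 -> inner l l = 0.
Proof.
  destruct l as [l1 l2], a1 as [x1 x2], a2 as [y1 y2]; coords; intros H E1 E2.
  assert (l1 = 0).
  { apply Rmult_eq_reg_r with (x1 * y2 - x2 * y1); [|exact H].
    transitivity ((l1 * x1 + l2 * x2) * y2 - (l1 * y1 + l2 * y2) * x2); [ring|].
    rewrite E1, E2; ring. }
  assert (l2 = 0).
  { apply Rmult_eq_reg_r with (x1 * y2 - x2 * y1); [|exact H].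
    transitivity ((l1 * y1 + l2 * y2) * x1 - (l1 * x1 + l2 * x2) * y1); [ring|].
    rewrite E1, E2; ring. }
  subst; ring.
Qed.

Lemma outside_near_base (y : C) :
  Rabs (fst y) <= / 2 -> Rabs (snd y) <= / 2 -> outside (base + y)%C.
Proof.
  destruct y as [y1 y2]; unfold base; coords; intros H1 H2.
  apply Rabs_le_between in H1, H2. nra.
Qed.

Definition germ_at_base (g : C -> C) (a1 a2 : C) (h : R) : Prop :=
  0 < h /\ forall y : C, Rabs (fst y) <= h -> Rabs (snd y) <= h ->
    g (base + y)%C = affine_map (g base) a1 a2 y.

Lemma image_cycle_along_arc (g : C -> C) (a1 a2 : C) (h : R) (q q' : cycle) :
  germ_at_base g a1 a2 h -> carries g q q' -> eval q base = 0 ->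
  eval q' (g base) = 0 /\
  exists s0, 0 < s0 /\ forall s, Rabs s <= s0 ->
    eval q' (affine_map (g base) a1 a2 (arc q s)) = 0.
Proof.
  intros [Hh Hg] (_ & _ & Hc) Hq. split.
  - apply Hc; [unfold base; coords; lra|exact Hq].
  - destruct (arc_small q (Rmin h (/ 2))) as (s0 & Hs0 & Hs);
      [apply Rmin_glb_lt; lra|].
    pose proof (Rmin_l h (/ 2)); pose proof (Rmin_r h (/ 2)).
    exists s0; split; [exact Hs0|].
    intros s Hss; destruct (Hs s Hss). rewrite <- Hg by lra.
    apply Hc; [apply outside_near_base; lra|now apply arc_on_cycle].
Qed.

(** A circle that goes to a circle: the pulled back image conic contains an arc of
    the circle, so by [conic_along_arc] its quadratic part, the multiple by
    [quad q'] of the Gram matrix of a1 and a2, is scalar. *)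
Lemma germ_conformal (g : C -> C) (a1 a2 : C) (h : R) :
  preserves_cycles g -> germ_at_base g a1 a2 h ->
  inner a1 a2 = 0 /\ inner a1 a1 = inner a2 a2.
Proof.
  intros (_ & _ & _ & Hcyc) Hgerm.
  (* Centre (2, 2), radius 2; the gradient at base is (-4, 0). *)
  set (q := Cycle 1 (-4, -4) 4).
  assert (Pq : proper q) by (unfold q; coords; lra).
  destruct (Hcyc q Pq) as (q' & Hq').
  assert (B : eval q base = 0) by (unfold q, base; coords; ring).
  destruct (image_cycle_along_arc g a1 a2 h q q' Hgerm Hq' B) as (B' & s0 & Hs0 & Hs).
  assert (Hd : quad q' <> 0).
  { intro E; apply (proj1 (proj2 Hq')) in E; unfold q in E; simpl in E; lra. }
  destruct (conic_along_arc q (quad q' * inner a1 a1) (quad q' * inner a1 a2)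
    (quad q' * inner a2 a2) (2 * quad q' * inner (g base) a1 + inner (lin q') a1)
    (2 * quad q' * inner (g base) a2 + inner (lin q') a2) s0 Hs0) as (_ & E1 & E2 & E3).
  - intros s Hss; cbv zeta. specialize (Hs s Hss). rewrite eval_affine_map, B' in Hs. lra.
  - unfold q, gradient in *; simpl in E1, E2, E3.
    split; apply Rmult_eq_reg_l with (quad q'); auto; lra.
Qed.

(** Both sides define cycles because the germ is a similarity. They share an arc
    at [base], so they are proportional. *)
Lemma pulled_back_cycle (g : C -> C) (a1 a2 : C) (h : R) (q q' : cycle) :
  germ_at_base g a1 a2 h -> cross a1 a2 <> 0 ->
  inner a1 a2 = 0 -> inner a1 a1 = inner a2 a2 ->
  proper q -> eval q base = 0 -> carries g q q' ->
  exists k, k <> 0 /\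
    forall y : C, eval q' (affine_map (g base) a1 a2 y) = k * eval q (base + y)%C.
Proof.
  intros Hgerm Hx H12 H11 Pq B Hq'.
  destruct (image_cycle_along_arc g a1 a2 h q q' Hgerm Hq' B) as (B' & s0 & Hs0 & Hs).
  pose proof (gradient_neq0 q Pq B) as HG.
  pose proof (proper_lin q' (proj1 Hq')) as Hl.
  set (r := inner a2 a2) in *.
  set (n1 := 2 * quad q' * inner (g base) a1 + inner (lin q') a1).
  set (n2 := 2 * quad q' * inner (g base) a2 + inner (lin q') a2).
  destruct (conic_along_arc q (quad q' * r) 0 (quad q' * r) n1 n2 s0 Hs0)
    as (E0 & E1 & _).
  - intros s Hss; cbv zeta. specialize (Hs s Hss).
    rewrite eval_affine_map, B', H12, H11 in Hs. fold n1 n2 r in Hs. lra.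
  - rewrite innerE in HG.
    assert (HB : 4 * quad q + 2 * snd (lin q) + cst q = 0)
      by (rewrite <- B; unfold base; coords; ring).
    unfold gradient in *; simpl fst in *; simpl snd in *.
    set (G1 := fst (lin q)) in *; set (G2 := 4 * quad q + snd (lin q)) in *.
    set (k := (n1 * G1 + n2 * G2) / (G1 * G1 + G2 * G2)).
    assert (K1 : n1 = k * G1).
    { unfold k. apply Rmult_eq_reg_r with (G1 * G1 + G2 * G2); [|lra].
      transitivity ((n1 * G1 + n2 * G2) * G1 - (n2 * G1 - n1 * G2) * G2); [ring|].
      rewrite E0; field; lra. }
    assert (K2 : n2 = k * G2).
    { unfold k. apply Rmult_eq_reg_r with (G1 * G1 + G2 * G2); [|lra].
      transitivity ((n1 * G1 + n2 * G2) * G2 + (n2 * G1 - n1 * G2) * G1); [ring|].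
      rewrite E0; field; lra. }
    assert (K3 : quad q' * r = k * quad q).
    { unfold k. apply Rmult_eq_reg_r with (G1 * G1 + G2 * G2); [|lra].
      transitivity (quad q * (n1 * G1 + n2 * G2)); [lra|field; lra]. }
    exists k; split.
    + intro Hk.
      assert (Hr : r <> 0).
      { intro Er. apply Hx.
        assert (inner a1 a1 = 0) by lra.
        clear - H. destruct a1 as [x1 x2], a2 as [y1 y2]; coords.
        assert (x1 = 0) as -> by nra. assert (x2 = 0) as -> by nra. ring. }
      assert (D' : quad q' = 0).
      { rewrite Hk, Rmult_0_l in K3. apply Rmult_integral in K3. tauto. }
      assert (inner (lin q') (lin q') = 0); [|lra].
      apply inner_both_zero with a1 a2; [exact Hx|..].
      * unfold n1 in K1. rewrite D', Hk in K1. lra.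
      * unfold n2 in K2. rewrite D', Hk in K2. lra.
    + intro y. rewrite eval_affine_map, B', H12, H11. fold n1 n2 r.
      rewrite K1, K2. transitivity (quad q' * r * (fst y ^ 2 + snd y ^ 2)
        + k * G1 * fst y + k * G2 * snd y); [ring|]. rewrite K3.
      unfold eval. rewrite !innerE. unfold base; simpl. unfold G1, G2.
      transitivity (k * (quad q * (fst y ^ 2 + snd y ^ 2) + fst (lin q) * fst y +
        (4 * quad q + snd (lin q)) * snd y
        + (4 * quad q + 2 * snd (lin q) + cst q))); [rewrite HB; ring|ring].
Qed.

(** Two members of the pencil of cycles through x and [base], one on each
    side of its geodesic member: the equation of the geodesic plus or minus
    half that of the line through x and [base] or, when this line is itself the
    geodesic, plus or minus that of the circle with diameter from x to [base].
    Their common points are those of the whole pencil. *)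
Lemma cycles_meeting_only_at (x : C) :
  outside x -> x <> base ->
  exists q1 q2, proper q1 /\ proper q2 /\
    eval q1 base = 0 /\ eval q2 base = 0 /\ eval q1 x = 0 /\ eval q2 x = 0 /\
    forall z, eval q1 z = 0 -> eval q2 z = 0 -> z = x \/ z = base.
Proof.
  destruct x as [x1 x2]; unfold base; intros Ho Hx.
  destruct (Req_dec x1 0) as [->|H1].
  - assert (H2 : x2 <> 2) by (intros ->; now apply Hx).
    exists (Cycle 1 (2 * x2, - (x2 + 2)) (2 * x2)),
           (Cycle (-1) (2 * x2, x2 + 2) (- 2 * x2)).
    coords. repeat split; try nra.
    intros [z1 z2] Hz1 Hz2; coords.
    assert (z1 = 0) as ->.
    { apply Rmult_eq_reg_l with x2; nra. }
    assert (E : (z2 - x2) * (z2 - 2) = 0) by lra.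
    apply Rmult_integral in E. destruct E; [left|right]; f_equal; lra.
    (* (a, - 5 x1) with quad = cst = 2 x1 is the geodesic through x and base;
       (x2 - 2, - x1) with quad = 0 and cst = 2 x1 is the line. *)
  - set (a := 5 * x2 - 2 * (1 + (x1 * x1 + x2 * x2))).
    exists (Cycle (2 * x1) (a + (x2 - 2) / 2, - 5 * x1 - x1 / 2) (3 * x1)),
           (Cycle (2 * x1) (a - (x2 - 2) / 2, - 5 * x1 + x1 / 2) x1).
    assert (0 < x1 ^ 2) by now apply pow2_gt_0.
    pose proof (pow2_ge_0 (a + (x2 - 2) / 2)).
    pose proof (pow2_ge_0 (a - (x2 - 2) / 2)).
    coords. repeat split; try lra; try (unfold a; field).
    intros [z1 z2] Hz1 Hz2; coords.
    assert (L : (x2 - 2) * z1 - x1 * z2 + 2 * x1 = 0) by lra.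
    assert (Q : 2 * x1 * (z1 * z1 + z2 * z2) + a * z1 - 5 * x1 * z2 + 2 * x1 = 0) by lra.
    clear Hz1 Hz2.
    assert (Z2 : z2 = 2 + z1 / x1 * (x2 - 2)).
    { apply Rmult_eq_reg_l with x1; [|exact H1].
      transitivity (2 * x1 + z1 * (x2 - 2)); [lra|field; exact H1]. }
    set (t := z1 / x1) in *.
    assert (Z1 : z1 = t * x1) by (unfold t; field; exact H1).
    clearbody t; subst z1 z2.
    assert (E : 2 * x1 * (x1 ^ 2 + (x2 - 2) ^ 2) * (t * (t - 1)) = 0).
    { rewrite <- Q. unfold a; ring. }
    assert (P : 0 < x1 ^ 2 + (x2 - 2) ^ 2) by (pose proof (pow2_ge_0 (x2 - 2)); lra).
    apply Rmult_integral in E. destruct E as [E|E].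
    + exfalso. apply Rmult_integral in E. destruct E; [|lra]. lra.
    + apply Rmult_integral in E. destruct E as [->|E]; [right|left].
      * f_equal; ring.
      * replace t with 1 by lra. f_equal; ring.
Qed.

Lemma affine_map_surjective (o a1 a2 z : C) :
  cross a1 a2 <> 0 -> exists y, affine_map o a1 a2 y = z.
Proof.
  intro H. unfold cross in H.
  set (D := fst a1 * snd a2 - snd a1 * fst a2) in H.
  exists (((fst z - fst o) * snd a2 - (snd z - snd o) * fst a2) / D,
          ((snd z - snd o) * fst a1 - (fst z - fst o) * snd a1) / D).
  destruct z as [z1 z2]. unfold affine_map; simpl. f_equal; unfold D; field; exact H.
Qed.

Lemma affine_map_injective (o a1 a2 y y' : C) :
  cross a1 a2 <> 0 -> affine_map o a1 a2 y = affine_map o a1 a2 y' -> y = y'.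
Proof.
  intros H E. destruct y as [y1 y2], y' as [y1' y2'].
  unfold cross, affine_map in *; simpl in E. injection E as E1 E2.
  f_equal; (apply Rmult_eq_reg_r with (fst a1 * snd a2 - snd a1 * fst a2);
            [|exact H]).
  - transitivity ((y1 * fst a1 + y2 * fst a2) * snd a2
                  - (y1 * snd a1 + y2 * snd a2) * fst a2); [ring|].
    replace (y1 * fst a1 + y2 * fst a2) with (y1' * fst a1 + y2' * fst a2) by lra.
    replace (y1 * snd a1 + y2 * snd a2) with (y1' * snd a1 + y2' * snd a2) by lra.
    ring.
  - transitivity ((y1 * snd a1 + y2 * snd a2) * fst a1
                  - (y1 * fst a1 + y2 * fst a2) * snd a1); [ring|].
    replace (y1 * fst a1 + y2 * fst a2) with (y1' * fst a1 + y2' * fst a2) by lra.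
    replace (y1 * snd a1 + y2 * snd a2) with (y1' * snd a1 + y2' * snd a2) by lra.
    ring.
Qed.

Lemma Cplus_cancel_l (a b c : C) : (a + b = a + c)%C -> b = c.
Proof.
  intro H. replace b with (a + b - a)%C by ring. rewrite H; ring.
Qed.

(** Every proper cycle through [base] and x is sent by g where the similarity
    sends it, by [pulled_back_cycle]; two cycles that meet only at x and [base]
    leave g x no choice, as the image of [base] is already taken. *)
Lemma germ_determines_map (g : C -> C) (a1 a2 : C) (h : R) :
  preserves_cycles g -> germ_at_base g a1 a2 h -> cross a1 a2 <> 0 ->
  forall y, outside (base + y)%C -> g (base + y)%C = affine_map (g base) a1 a2 y.
Proof.
  intros Hg Hgerm Hx y Hy.
  destruct (germ_conformal g a1 a2 h Hg Hgerm) as [H12 H11].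
  destruct Hg as (_ & Hinj & _ & Hcyc).
  assert (A0 : affine_map (g base) a1 a2 0 = g base)
    by (unfold affine_map; simpl; destruct (g base); simpl; f_equal; ring).
  destruct (Ceq_dec y 0) as [->|Hy0].
  { now rewrite A0, Cplus_0_r. }
  assert (Hyb : (base + y)%C <> base).
  { intro E. apply Hy0, (Cplus_cancel_l base). now rewrite Cplus_0_r. }
  destruct (cycles_meeting_only_at _ Hy Hyb)
    as (q1 & q2 & P1 & P2 & B1 & B2 & X1 & X2 & Hz).
  destruct (affine_map_surjective (g base) a1 a2 (g (base + y)%C) Hx) as (y' & Ey').
  assert (Hon : forall q, proper q -> eval q base = 0 -> eval q (base + y)%C = 0 ->
            eval q (base + y')%C = 0).
  { intros q Pq Bq Xq. destruct (Hcyc q Pq) as (q' & Hq').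
    destruct (pulled_back_cycle g a1 a2 h q q' Hgerm Hx H12 H11 Pq Bq Hq')
      as (k & Hk & E).
    apply (proj2 (proj2 Hq') _ Hy) in Xq. rewrite <- Ey', E in Xq.
    apply Rmult_integral in Xq. tauto. }
  rewrite <- Ey'.
  destruct (Hz (base + y')%C (Hon q1 P1 B1 X1) (Hon q2 P2 B2 X2)) as [E|E].
  - now rewrite (Cplus_cancel_l _ _ _ E).
  - exfalso. assert (y' = 0) as ->.
    { apply (Cplus_cancel_l base). now rewrite E, Cplus_0_r. }
    rewrite A0 in Ey'. apply Hyb. symmetry. apply Hinj; auto.
    unfold base; coords; lra.
Qed.

(** * Similarities preserving the exterior of the disc *)

Lemma inner_affine_map (v a1 a2 w : C) (r : R) :
  inner a1 a2 = 0 -> inner a1 a1 = r -> inner a2 a2 = r ->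
  inner (affine_map v a1 a2 w) (affine_map v a1 a2 w) =
  inner v v + r * inner w w + 2 * (fst w * inner v a1 + snd w * inner v a2).
Proof.
  intros E E1 E2.
  transitivity (inner v v + (fst w * fst w * inner a1 a1 + snd w * snd w * inner a2 a2
     + 2 * fst w * snd w * inner a1 a2)
    + 2 * (fst w * inner v a1 + snd w * inner v a2)).
  - unfold affine_map; rewrite !innerE; simpl; ring.
  - rewrite E, E1, E2, (innerE w w); ring.
Qed.

(** The closed disc is mapped into itself, so a diameter gives |v|^2 + r <= 1.
    If v were nonzero, the point that is sent to - v / |v| would lie outside the
    disc, although its image lies on the unit circle; so v = 0, and likewise
    r < 1 would send the circle of radius 1 / sqrt r to the unit circle. *)
Lemma similarity_of_exterior (v a1 a2 : C) (r : R) :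
  cross a1 a2 <> 0 -> inner a1 a2 = 0 -> inner a1 a1 = r -> inner a2 a2 = r ->
  (forall w, outside w -> outside (affine_map v a1 a2 w)) ->
  (forall z, outside z -> exists w, outside w /\ affine_map v a1 a2 w = z) ->
  inner v v = 0 /\ r = 1.
Proof.
  intros Hx H12 H11 H22 Hout Hsurj.
  assert (Hin : forall w, inner w w <= 1 ->
      inner (affine_map v a1 a2 w) (affine_map v a1 a2 w) <= 1).
  { intros w Hw. apply Rnot_lt_le. intro H.
    destruct (Hsurj _ H) as (w' & Hw' & E).
    apply affine_map_injective in E; [|exact Hx]. subst w'.
    unfold outside in Hw'. lra. }
  assert (Hr : 0 < r).
  { rewrite <- H11. apply inner_neq0. intros ->. apply Hx. unfold cross; simpl; ring. }
  assert (Hvv : 0 <= inner v v) by (rewrite innerE; nra).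
  assert (Hsum : inner v v + r <= 1).
  { pose proof (Hin (1, 0) ltac:(coords; lra)) as P.
    pose proof (Hin (-1, 0) ltac:(coords; lra)) as M.
    rewrite (inner_affine_map v a1 a2 _ r) in P by auto.
    rewrite (inner_affine_map v a1 a2 _ r) in M by auto.
    rewrite (innerE (1, 0)) in P. rewrite (innerE (-1, 0)) in M.
    simpl in P, M. lra. }
  assert (Hv : inner v v = 0).
  { destruct (Rle_lt_or_eq_dec _ _ Hvv) as [Hv|Hv]; [exfalso|now symmetry].
    set (n := sqrt (inner v v)).
    assert (Hn : 0 < n) by now apply sqrt_lt_R0.
    assert (Hnn : n * n = inner v v) by (apply sqrt_sqrt; lra).
    (* w is sent to (1 - k r) v = - v / |v|. *)
    set (k := (1 + 1 / n) / r).
    set (w := (- k * inner v a1, - k * inner v a2) : C).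
    assert (Hs : inner v a1 ^ 2 + inner v a2 ^ 2 = r * (n * n)).
    { assert (Hd : (cross a1 a2) ^ 2 = r * r).
      { rewrite <- H11 at 1. rewrite <- H22.
        transitivity (inner a1 a1 * inner a2 a2 - inner a1 a2 ^ 2);
          [coords; ring|rewrite H12; ring]. }
      apply Rmult_eq_reg_l with r; [|lra].
      rewrite Hnn.
      transitivity (inner v v * cross a1 a2 ^ 2); [|rewrite Hd; ring].
      transitivity (inner a2 a2 * inner v a1 ^ 2 + inner a1 a1 * inner v a2 ^ 2
          - 2 * inner a1 a2 * inner v a1 * inner v a2);
        [rewrite H11, H22, H12; ring|coords; ring]. }
    assert (Eww : inner w w = k ^ 2 * (r * (n * n)))
      by (rewrite <- Hs, innerE; unfold w; simpl; ring).
    assert (Ow : outside w).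
    { unfold outside. rewrite Eww.
      replace (k ^ 2 * (r * (n * n))) with ((1 + n) ^ 2 / r)
        by (unfold k; field; split; lra).
      apply Rlt_div_r; [lra|]. nra. }
    apply Hout in Ow. unfold outside in Ow.
    rewrite (inner_affine_map v a1 a2 _ r), Eww, <- Hnn in Ow by auto.
    assert (E : n * n + r * (k ^ 2 * (r * (n * n)))
        + 2 * (fst w * inner v a1 + snd w * inner v a2) = 1).
    { transitivity (n * n + r * (k ^ 2 * (r * (n * n)))
         - 2 * k * (inner v a1 ^ 2 + inner v a2 ^ 2)); [unfold w; simpl; ring|].
      rewrite Hs. unfold k. field. split; lra. }
    lra. }
  split; [exact Hv|].
  destruct (Rle_lt_or_eq_dec r 1 ltac:(lra)) as [Hlt|]; [exfalso|assumption].
  set (s := sqrt r).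
  assert (Hs : 0 < s) by now apply sqrt_lt_R0.
  assert (Hss : s * s = r) by (apply sqrt_sqrt; lra).
  assert (V : fst v = 0 /\ snd v = 0) by (rewrite innerE in Hv; split; nra).
  assert (O : outside (1 / s, 0)).
  { unfold outside; rewrite innerE; simpl.
    replace (1 / s * (1 / s) + 0 * 0) with (1 / (s * s)) by (field; lra).
    rewrite Hss. apply Rlt_div_r; lra. }
  apply Hout in O. unfold outside in O.
  rewrite (inner_affine_map v a1 a2 _ r), Hv, !innerE in O by auto; simpl in O.
  rewrite (proj1 V), (proj2 V) in O.
  assert (r * (1 / s * (1 / s)) = 1) by (rewrite <- Hss; field; lra).
  lra.
Qed.

Lemma preserves_cycles_norm (g : C -> C) :
  preserves_cycles g ->
  forall w, outside w -> inner (g w) (g w) = inner w w.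
Proof.
  intro Hg.
  destruct (locally_affine g Hg) as (h & a1 & a2 & Hh & Hx & Haff).
  assert (Hgerm : germ_at_base g a1 a2 h) by now split.
  destruct (germ_conformal g a1 a2 h Hg Hgerm) as [H12 H11].
  set (v := (fst (g base) - 2 * fst a2, snd (g base) - 2 * snd a2) : C).
  assert (Hall : forall w, outside w -> g w = affine_map v a1 a2 w).
  { intros w Hw. replace w with (base + (w - base))%C in Hw |- * by ring.
    rewrite (germ_determines_map g a1 a2 h Hg Hgerm Hx _ Hw).
    unfold affine_map, v, base; simpl; f_equal; ring. }
  destruct (similarity_of_exterior v a1 a2 (inner a2 a2) Hx H12 H11 eq_refl) as [Hv Hr].
  - intros w Hw. rewrite <- Hall by exact Hw. now apply Hg.
  - intros z Hz. destruct (proj1 (proj2 (proj2 Hg)) z Hz) as (w & Hw & E).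
    exists w; split; [exact Hw|]. now rewrite <- Hall.
  - intros w Hw. rewrite Hall by assumption.
    rewrite (inner_affine_map v a1 a2 w (inner a2 a2)) by auto.
    rewrite Hv, Hr.
    assert (V : fst v = 0 /\ snd v = 0) by (rewrite innerE in Hv; split; nra).
    rewrite (innerE v a1), (innerE v a2). destruct V as [-> ->]. ring.
Qed.

(** * The chart at a point *)

Lemma H2_ext (z w : H2) : Re z = Re w -> Im z = Im w -> z = w.
Proof.
  destruct z as [[x y] Hz], w as [[x' y'] Hw]; simpl; intros -> ->.
  f_equal; apply proof_irrelevance.
Qed.

Lemma circle_equation (c : C) (r : R) (z : C) :
  0 < r -> (circle c r z <-> (Re z - Re c) ^ 2 + (Im z - Im c) ^ 2 = r ^ 2).
Proof.
  intro Hr. destruct z as [x y], c as [a b]; unfold circle, Cmod; simpl.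
  set (s := (x + - a) * ((x + - a) * 1) + (y + - b) * ((y + - b) * 1)).
  replace ((x - a) * ((x - a) * 1) + (y - b) * ((y - b) * 1)) with s by (unfold s; ring).
  assert (Hs : 0 <= s)
    by (unfold s; pose proof (pow2_ge_0 (x + - a)); pose proof (pow2_ge_0 (y + - b));
        simpl in *; lra).
  split; intro E.
  - rewrite <- (sqrt_sqrt s Hs), E; ring.
  - rewrite E. replace (r * (r * 1)) with (Rsqr r) by (unfold Rsqr; ring).
    apply sqrt_Rsqr; lra.
Qed.

(** A circle crosses the real axis in two points iff the discriminant in x is
    positive, and is orthogonal to it iff its centre is real, that is, ga = 0; a
    line is horizontal iff be = 0 and vertical iff ga = 0. *)
Lemma hypercycle_equation (h : Ensemble H2) :
  is_hypercycle h <->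
  exists al be ga de : R, ga <> 0 /\ 4 * al * de < be ^ 2 /\
    forall z : H2, h z <-> al * (Re z ^ 2 + Im z ^ 2) + be * Re z + ga * Im z + de = 0.
Proof.
  split.
  - intros [(c & r & Hr & (a & b & Hab & Ha & Hb) & Horth & Hh1 & Hh2)
           |(p & d & Hd & Hv & Hz & Hh1 & Hh2)].
    + destruct c as [cx cy].
      apply circle_equation in Ha, Hb; [|exact Hr..]; simpl in Ha, Hb.
      assert (Hcy : cy <> 0).
      { intros ->. apply Horth. intros t _. coords. ring. }
      assert (Hlt : cy ^ 2 < r ^ 2).
      { apply Rnot_le_lt; intro H.
        assert (a - cx = 0) by nra. assert (b - cx = 0) by nra. lra. }
      exists 1, (- 2 * cx), (- 2 * cy), (cx ^ 2 + cy ^ 2 - r ^ 2).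
      split; [lra|split; [lra|]].
      intro z. transitivity (circle (cx, cy) r z).
      * split; [apply Hh1|apply Hh2].
      * rewrite circle_equation by exact Hr. simpl Re at 2; simpl Im at 2.
        change (Re (cx, cy)) with cx. change (Im (cx, cy)) with cy. split; intro; lra.
    + destruct p as [px py], d as [dx dy]. unfold vertical, horizontal in *; simpl in Hv, Hz.
      exists 0, dy, (- dx), (dx * py - dy * px).
      split; [lra|split].
      { assert (0 < dy ^ 2) by now apply pow2_gt_0. lra. }
      intro z. transitivity (line (px, py) (dx, dy) z).
      * split; [apply Hh1|apply Hh2].
      * unfold line. destruct (pt z) as [x y]; unfold Re, Im; simpl. split.
        -- intros [t E]. injection E as -> ->. ring.
        -- intro E. exists ((y - py) / dy). unfold Cplus, Cmult; simpl. f_equal.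
           ++ apply Rmult_eq_reg_l with dy; [|exact Hz]. field_simplify; [lra|exact Hz].
           ++ field; exact Hz.
  - intros (al & be & ga & de & Hga & Hdisc & Hh).
    destruct (Req_dec al 0) as [->|Hal]; [right|left].
    + assert (Hbe : be <> 0) by nra.
      exists (- de / be, 0), (ga, - be). unfold vertical, horizontal; simpl.
      split; [intro E; now injection E|split; [exact Hga|split; [lra|]]].
      assert (Hl : forall z : H2, h z <-> line (- de / be, 0) (ga, - be) z).
      { intro z. rewrite Hh. unfold line. destruct (pt z) as [x y]; unfold Re, Im; simpl.
        split.
        - intro E. exists (- y / be). unfold Cplus, Cmult; simpl. f_equal.
          + apply Rmult_eq_reg_l with be; [|exact Hbe]. field_simplify; [lra|exact Hbe].
          + field; exact Hbe.
        - intros [t E]. injection E as -> ->. field; exact Hbe. }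
      split; intros z; apply Hl.
    + set (cx := - be / (2 * al)); set (cy := - ga / (2 * al)).
      set (k := (be ^ 2 - 4 * al * de) / (2 * al) ^ 2).
      assert (Hk : 0 < k).
      { apply Rdiv_lt_0_compat; [lra|]. apply pow2_gt_0. lra. }
      assert (Hcy : cy <> 0).
      { unfold cy, Rdiv. apply Rmult_integral_contrapositive_currified; [lra|].
        apply Rinv_neq_0_compat; lra. }
      assert (Hcy2 : 0 < cy ^ 2) by now apply pow2_gt_0.
      set (r := sqrt (cy ^ 2 + k)).
      assert (Hr : 0 < r) by (apply sqrt_lt_R0; lra).
      assert (Hrr : r ^ 2 = cy ^ 2 + k) by (apply pow2_sqrt; lra).
      assert (Hkk : sqrt k ^ 2 = k) by (apply pow2_sqrt; lra).
      assert (Hk0 : 0 < sqrt k) by now apply sqrt_lt_R0.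
      assert (Hreal : forall t : R, (t - cx) ^ 2 = k -> circle (cx, cy) r t).
      { intros t Ht. apply circle_equation; [exact Hr|]. simpl Re; simpl Im.
        rewrite Hrr, Ht; ring. }
      exists (cx, cy), r. split; [exact Hr|split; [|split]].
      * exists (cx + sqrt k), (cx - sqrt k). split; [lra|].
        split; apply Hreal; rewrite <- Hkk at 2; ring.
      * intro Ho. specialize (Ho (cx + sqrt k)).
        apply Hcy. rewrite <- Ho.
        -- coords. ring.
        -- apply Hreal. rewrite <- Hkk at 2; ring.
      * assert (Hc : forall z : H2, h z <-> circle (cx, cy) r z).
        { intro z. rewrite Hh, circle_equation, Hrr by exact Hr.
          change (Re (cx, cy)) with cx. change (Im (cx, cy)) with cy.
          assert (E : al * (Re z ^ 2 + Im z ^ 2) + be * Re z + ga * Im z + de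
            = al * ((Re z - cx) ^ 2 + (Im z - cy) ^ 2 - (cy ^ 2 + k)))
            by (unfold cx, cy, k; field; exact Hal).
          rewrite E. split; intro H.
          - apply Rmult_integral in H. destruct H; [contradiction|lra].
          - rewrite H; ring. }
        split; intros z; apply Hc.
Qed.

Definition chart (p z : H2) : C := ((z - Cconj p) / (z - p))%C.

Definition sqdist (z w : C) : R := (Re z - Re w) ^ 2 + (Im z - Im w) ^ 2.

Lemma sqdist_pos (z p : H2) : z <> p -> 0 < sqdist z p.
Proof.
  intro H. unfold sqdist.
  pose proof (pow2_ge_0 (Re z - Re p)); pose proof (pow2_ge_0 (Im z - Im p)).
  destruct (Req_dec (Re z) (Re p)) as [E1|E1].
  - destruct (Req_dec (Im z) (Im p)) as [E2|E2].
    + now destruct H; apply H2_ext.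
    + assert (0 < (Im z - Im p) ^ 2) by (apply pow2_gt_0; lra). lra.
  - assert (0 < (Re z - Re p) ^ 2) by (apply pow2_gt_0; lra). lra.
Qed.

Lemma chart_coordinates (p z : H2) :
  z <> p ->
  chart p z = (((Re z - Re p) ^ 2 + Im z ^ 2 - Im p ^ 2) / sqdist z p,
               2 * Im p * (Re z - Re p) / sqdist z p).
Proof.
  intro H. pose proof (sqdist_pos z p H) as D. unfold sqdist in *.
  destruct z as [[x y] Hz], p as [[a b] Hp]; simpl in *.
  unfold chart, Cdiv, Cmult, Cinv; simpl.
  f_equal; field; lra.
Qed.

(** This gives both that the chart takes values outside the unit disc and that
    the norm determines the distance to p. *)
Lemma chart_norm (p z : H2) :
  z <> p -> inner (chart p z) (chart p z) = 1 + 4 * Im p * Im z / sqdist z p.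
Proof.
  intro H. rewrite chart_coordinates, innerE by exact H.
  pose proof (sqdist_pos z p H) as D. unfold sqdist in *; simpl fst; simpl snd.
  field. lra.
Qed.

Lemma chart_outside (p z : H2) : z <> p -> outside (chart p z).
Proof.
  intro H. unfold outside. rewrite chart_norm by exact H.
  assert (0 < 4 * Im p * Im z / sqdist z p); [|lra].
  apply Rdiv_lt_0_compat; [|now apply sqdist_pos].
  pose proof (Im_pt_pos z); pose proof (Im_pt_pos p).
  apply Rmult_lt_0_compat; lra.
Qed.

(** The left-hand side is the squared Euclidean distance of the two images. *)
Lemma chart_inner (p z w : H2) :
  z <> p -> w <> p ->
  inner (chart p z) (chart p z) - 2 * inner (chart p z) (chart p w)
    + inner (chart p w) (chart p w)
  = 4 * Im p ^ 2 * sqdist z w / (sqdist z p * sqdist w p).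
Proof.
  intros Hz Hw. rewrite !chart_coordinates, !innerE by assumption.
  pose proof (sqdist_pos z p Hz); pose proof (sqdist_pos w p Hw).
  unfold sqdist in *; simpl fst; simpl snd.
  field. lra.
Qed.

Lemma chart_injective (p z w : H2) :
  z <> p -> w <> p -> chart p z = chart p w -> z = w.
Proof.
  intros Hz Hw E. pose proof (chart_inner p z w Hz Hw) as H. rewrite E in H.
  destruct (Classical_Prop.classic (z = w)) as [|Hne]; [assumption|exfalso].
  assert (0 < 4 * Im p ^ 2 * sqdist z w / (sqdist z p * sqdist w p)); [|lra].
  pose proof (Im_pt_pos p).
  pose proof (sqdist_pos z p Hz); pose proof (sqdist_pos w p Hw);
  pose proof (sqdist_pos z w Hne).
  apply Rdiv_lt_0_compat; repeat apply Rmult_lt_0_compat; lra.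
Qed.

Lemma chart_surjective (p : H2) (w : C) :
  outside w -> exists z : H2, z <> p /\ chart p z = w.
Proof.
  destruct w as [s t]; unfold outside; rewrite innerE; simpl; intro Hw.
  pose proof (Im_pt_pos p) as Hp.
  set (E := (s - 1) ^ 2 + t ^ 2).
  assert (HE : 0 < E).
  { unfold E. pose proof (pow2_ge_0 (s - 1)).
    destruct (Req_dec t 0) as [->|Ht].
    - assert (0 < (s - 1) ^ 2) by (apply pow2_gt_0; intro; assert (s = 1) as -> by lra; lra). lra.
    - assert (0 < t ^ 2) by now apply pow2_gt_0. lra. }
  assert (Hy : 0 < Im (Re p + 2 * Im p * t / E, Im p * (s * s + t * t - 1) / E)).
  { simpl. apply Rdiv_lt_0_compat; [|exact HE]. apply Rmult_lt_0_compat; lra. }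
  exists (mkH2 _ Hy).
  assert (Hne : mkH2 _ Hy <> p).
  { intro Eq. apply (f_equal pt) in Eq. simpl in Eq.
    assert (E1 := f_equal fst Eq); assert (E2 := f_equal snd Eq); simpl in E1, E2.
    unfold Re, Im in *. destruct (pt p) as [a b]; simpl in *.
    assert (T : t = 0).
    { apply Rmult_eq_reg_l with (2 * b / E).
      - transitivity (2 * b * t / E); [field|]; lra.
      - apply Rgt_not_eq, Rdiv_lt_0_compat; lra. }
    assert (S : b * (s * s + t * t - 1) = b * E).
    { rewrite <- E2 at 2. field; lra. }
    apply Rmult_eq_reg_l in S; [|lra]. unfold E in S. subst t. nra. }
  split; [exact Hne|].
  rewrite chart_coordinates by exact Hne.
  unfold sqdist; simpl.
  unfold Re, Im in *; destruct (pt p) as [a b]; simpl in *.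
  replace ((a + 2 * b * t / E - a) * ((a + 2 * b * t / E - a) * 1) +
    (b * (s * s + t * t - 1) / E - b) * ((b * (s * s + t * t - 1) / E - b) * 1))
    with (4 * b ^ 2 / E).
  - f_equal; unfold E; field; unfold E in HE; lra.
  - unfold E; field; unfold E in HE; lra.
Qed.

(** The equation [eval q] in the chart at p, multiplied by the squared distance
    to p so that it also makes sense at p. *)
Definition cleared (p : H2) (q : cycle) (z : H2) : R :=
  let X := Re z - Re p in
  quad q * (X ^ 2 + (Im z + Im p) ^ 2) + fst (lin q) * (X ^ 2 + Im z ^ 2 - Im p ^ 2)
  + snd (lin q) * (2 * Im p * X) + cst q * (X ^ 2 + (Im z - Im p) ^ 2).

Lemma cleared_center (p : H2) (q : cycle) : cleared p q p = 0 <-> quad q = 0.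
Proof.
  replace (cleared p q p) with (4 * Im p ^ 2 * quad q) by (unfold cleared; ring).
  pose proof (pow_lt (Im p) 2 (Im_pt_pos p)).
  split; intro E; [|rewrite E; ring].
  apply Rmult_integral in E. destruct E; [lra|assumption].
Qed.

Lemma cleared_chart (p : H2) (q : cycle) (z : H2) :
  z <> p -> (cleared p q z = 0 <-> eval q (chart p z) = 0).
Proof.
  intro H. pose proof (sqdist_pos z p H) as D.
  replace (cleared p q z) with (sqdist z p * eval q (chart p z)).
  - split; intro E; [|rewrite E; ring].
    apply Rmult_integral in E. destruct E; [lra|assumption].
  - unfold eval. rewrite chart_coordinates, !innerE by exact H. simpl fst; simpl snd.
    unfold cleared, sqdist in *. field. lra.
Qed.

(** Both sides are equations in the span of |z|^2, Re z, Im z, 1, and the change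
    of coefficients is linear and invertible. It multiplies ga by a nonzero
    number and the discriminant by a positive one. *)
Lemma hypercycle_cleared (p : H2) (h : Ensemble H2) :
  is_hypercycle h <->
  exists q, proper q /\ forall z : H2, h z <-> cleared p q z = 0.
Proof.
  pose proof (Im_pt_pos p) as Hp. rewrite hypercycle_equation. split.
  - intros (al & be & ga & de & Hga & Hdisc & Hh).
    set (b := be + 2 * al * Re p).
    set (d := (al * Re p ^ 2 + be * Re p + de) / Im p ^ 2).
    exists (Cycle ((al + d) / 4 + ga / (4 * Im p)) ((al - d) / 2, b / (2 * Im p))
                  ((al + d) / 4 - ga / (4 * Im p))).
    split; [split|].
    + rewrite innerE; simpl fst; simpl snd; simpl quad; simpl cst.
      apply Rlt_0_minus.
      replace (_ - _) with ((be ^ 2 - 4 * al * de) / (4 * Im p ^ 2))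
        by (unfold b, d; field; lra).
      apply Rdiv_lt_0_compat; [lra|]. apply Rmult_lt_0_compat; [lra|now apply pow_lt].
    + simpl. intro E. apply Hga. apply Rmult_eq_reg_r with (/ (4 * Im p)).
      * unfold Rdiv in E; lra.
      * apply Rinv_neq_0_compat; lra.
    + intro z. rewrite Hh. unfold cleared; simpl fst; simpl snd; simpl quad; simpl cst.
      match goal with |- ?A = 0 <-> ?B = 0 => replace B with A; [reflexivity|] end.
      unfold b, d; field; lra.
  - intros (q & [H1 H2] & Hh). destruct q as [a [l1 l2] c]. simpl in H1, H2.
    set (al := a + l1 + c). set (b := 2 * Im p * l2).
    set (d := Im p ^ 2 * (a - l1 + c)).
    exists al, (b - 2 * Re p * al), (2 * Im p * (a - c)), (d - b * Re p + al * Re p ^ 2).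
    split; [|split].
    + apply Rmult_integral_contrapositive_currified; lra.
    + apply Rlt_0_minus. rewrite innerE in H1; simpl in H1.
      replace (_ - _) with (4 * Im p ^ 2 * (l1 * l1 + l2 * l2 - (a + c) ^ 2))
        by (unfold al, b, d; ring).
      apply Rmult_lt_0_compat; [|simpl; lra].
      apply Rmult_lt_0_compat; [lra|now apply pow_lt].
    + intro z. rewrite Hh. unfold cleared; simpl fst; simpl snd; simpl quad; simpl cst.
      match goal with |- ?A = 0 <-> ?B = 0 => replace B with A; [reflexivity|] end.
      unfold al, b, d; ring.
Qed.

(** * Distances *)

(** Rewriting the distance in terms of one quotient reduces isometry to the
    preservation of that quotient. *)
Lemma hdist_sqdist (z w : H2) :
  hdist z w = 2 * arcsinh (sqrt (sqdist z w / (Im z * Im w)) / 2).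
Proof.
  unfold hdist. do 2 f_equal.
  assert (Hm : 0 < Im z * Im w) by (apply Rmult_lt_0_compat; apply Im_pt_pos).
  assert (Hs : 0 <= sqdist z w).
  { unfold sqdist. pose proof (pow2_ge_0 (Re z - Re w)).
    pose proof (pow2_ge_0 (Im z - Im w)). lra. }
  rewrite sqrt_div by lra.
  replace (Cmod (z - w)) with (sqrt (sqdist z w)) by reflexivity.
  field. apply Rgt_not_eq, sqrt_lt_R0, Hm.
Qed.

(** The distance to p is a function of the norm in the chart at p; this is why it
    suffices that g preserves norms. *)
Lemma sqdist_chart_center (p z : H2) :
  z <> p ->
  sqdist z p / (Im z * Im p) = 4 / (inner (chart p z) (chart p z) - 1).
Proof.
  intro Hz. rewrite chart_norm by assumption.
  pose proof (sqdist_pos z p Hz).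
  pose proof (Im_pt_pos p); pose proof (Im_pt_pos z).
  replace (1 + 4 * Im p * Im z / sqdist z p - 1)
    with (4 * Im p * Im z / sqdist z p) by ring.
  field. lra.
Qed.

Lemma chart_conjugate_preserves (f : H2 -> H2) (p : H2) :
  Bijective f ->
  (forall h, is_hypercycle h -> is_hypercycle (Image.Im H2 H2 h f)) ->
  exists g, preserves_cycles g /\ forall z, z <> p -> chart (f p) (f z) = g (chart p z).
Proof.
  intros (f' & Hf'f & Hff') Hhyp.
  assert (Hinj : forall z w, f z = f w -> z = w)
    by (intros z w E; rewrite <- (Hf'f z), E; apply Hf'f).
  destruct (functional_choice
      (fun (w : C) (z : H2) => outside w -> z <> p /\ chart p z = w)) as (u & Hu).
  { intro w. destruct (classic (outside w)) as [H|H].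
    - destruct (chart_surjective p w H) as (z & Hz). now exists z.
    - exists p. tauto. }
  assert (Huc : forall z, z <> p -> u (chart p z) = z).
  { intros z Hz. destruct (Hu _ (chart_outside p z Hz)) as [H1 H2].
    now apply (chart_injective p). }
  assert (Hfu : forall w, outside w -> f (u w) <> f p).
  { intros w Hw E. apply Hinj in E. now apply (Hu w Hw). }
  exists (fun w => chart (f p) (f (u w))).
  split; [|intros z Hz; now rewrite Huc].
  split; [|split; [|split]].
  - intros w Hw. apply chart_outside. auto.
  - intros w w' Hw Hw' E. apply chart_injective in E; auto.
    apply Hinj in E. destruct (Hu w Hw) as [_ <-], (Hu w' Hw') as [_ <-].
    now rewrite E.
  - intros w' Hw'. destruct (chart_surjective (f p) w' Hw') as (z' & Hz' & E).
    assert (Hz : f' z' <> p) by (intro Eq; apply Hz'; now rewrite <- Eq, Hff').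
    exists (chart p (f' z')). split; [now apply chart_outside|].
    now rewrite Huc, Hff'.
  - intros q Pq.
    set (h := fun z : H2 => cleared p q z = 0).
    assert (Hh : is_hypercycle h) by (apply (hypercycle_cleared p); now exists q).
    apply Hhyp, (hypercycle_cleared (f p)) in Hh. destruct Hh as (q' & Pq' & Hq').
    assert (Him : forall z, h z <-> cleared (f p) q' (f z) = 0).
    { intro z. rewrite <- Hq'. split.
      - intro Hz. now apply Image.Im_intro with z.
      - intro Hz. inversion Hz as [z0 Hz0 y Ey]. apply Hinj in Ey. now subst. }
    exists q'. split; [exact Pq'|split].
    + rewrite <- (cleared_center p q), <- (cleared_center (f p) q'). apply Him.
    + intros w Hw. destruct (Hu w Hw) as [H1 H2]. rewrite <- H2 at 1.
      rewrite <- cleared_chart, <- cleared_chart by auto. apply Him.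
Qed.

Theorem theorem2 (f : H2 -> H2)
  (f_bij : Bijective f)
  (f_hyp : forall h : Ensemble H2, is_hypercycle h -> is_hypercycle (Image.Im H2 H2 h f)) :
  is_isometry f.
Proof.
  split; [exact f_bij|].
  intros z w. rewrite !hdist_sqdist. do 4 f_equal.
  destruct (classic (z = w)) as [->|Hzw].
  { unfold sqdist. rewrite !Rminus_diag. unfold Rdiv. ring. }
  assert (Hf : f z <> f w).
  { destruct f_bij as (f' & Hf'f & _). intro E. apply Hzw.
    now rewrite <- (Hf'f z), E, Hf'f. }
  destruct (chart_conjugate_preserves f w f_bij f_hyp) as (g & Hg & Hgf).
  rewrite !sqdist_chart_center by assumption.
  rewrite Hgf by exact Hzw.
  rewrite (preserves_cycles_norm g Hg) by now apply chart_outside.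
  reflexivity.
Qed.
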